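(* In the Wyner-Ziv problem with a helper described in the context, where $Y-Z-X$ is a Markov chain, the operational achievable region equals the single-letter region: $\mathcal R^O_{Y-Z-X}(D)=\mathcal R_{Y-Z-X}(D)$.
   Context: Let $\mathcal X,\mathcal Y,\mathcal Z,\hat{\mathcal X}$ be finite alphabets, $d:\mathcal X\times\hat{\mathcal X}\to[0,\infty)$ a distortion measure, and $(X_i,Y_i,Z_i)$ i.i.d. with distribution $p(x,y,z)=p(z,y)p(x|z)$ (Markov chain $Y-Z-X$). A helper observing $Y^n$ sends a message $T_1=f_1(Y^n)\in\{1,\dots,2^{nR_1}\}$ to both the encoder and the decoder; the encoder observing $X^n$ sends $T=f(X^n,T_1)\in\{1,\dots,2^{nR}\}$ to the decoder; the decoder observes side information $Z^n$ and outputs $\hat X^n=g(T,T_1,Z^n)\in\hat{\mathcal X}^n$. A pair $(R,R_1)$ is achievable at distortion $D$ if for every $\epsilon>0$ and all sufficiently large $n$ there exist such $f_1,f,g$ with $\mathbb E\big[\frac1n\sum_{i=1}^n d(X_i,\hat X_i)\big]\le D+\epsilon$; $\mathcal R^O_{Y-Z-X}(D)$ is the closure of the set of achievable pairs. $\mathcal R_{Y-Z-X}(D)$ is the set of all pairs $(R,R_1)$ with $R_1\ge I(U;Y|X)$ and $R\ge I(X;V|U,Z)$ for some finite-alphabet auxiliary random variables $U,V$ with joint distribution $p(x,y,z,u,v)=p(z,y)p(x|z)p(u|y)p(v|x,u)$ and a deterministic function $\hat X(U,V,Z)$ with $\mathbb E\, d(X,\hat X(U,V,Z))\le D$. *)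

(* Defs.v *)
From mathcomp Require Import all_boot all_order all_algebra.
From mathcomp Require Import reals exp.
Set Implicit Arguments. Unset Strict Implicit. Unset Printing Implicit Defensive.
Import Order.TTheory GRing.Theory Num.Theory.
Local Open Scope ring_scope.

Section WZHelper.
Variable R : realType.

(** logarithm in base 2 (rates are in bits, message sets have size 2^{nR}) *)
Definition log2 (x : R) : R := ln x / ln 2.

Definition is_pmf (T : finType) (p : T -> R) : Prop :=
  (forall t, 0 <= p t) /\ \sum_(t : T) p t = 1.

Definition is_channel (A B : finType) (W : A -> B -> R) : Prop :=
  forall a, is_pmf (W a).

Definition cond_mutual_info (T TA TB TC : finType) (P : T -> R)
    (A : T -> TA) (B : T -> TB) (C : T -> TC) : R :=
  \sum_(a : TA) \sum_(b : TB) \sum_(c : TC)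
    let pabc := \sum_(t | (A t == a) && (B t == b) && (C t == c)) P t in
    let pac  := \sum_(t | (A t == a) && (C t == c)) P t in
    let pbc  := \sum_(t | (B t == b) && (C t == c)) P t in
    let pc   := \sum_(t | C t == c) P t in
    if 0 < pabc then pabc * log2 (pabc * pc / (pac * pbc)) else 0.

Variables (X Y Z Xh : finType).
Variable pZY : Z * Y -> R.
Variable W : Z -> X -> R.           (* p(x|z) *)
Variable d : X -> Xh -> R.

Definition pXYZ (x : X) (y : Y) (z : Z) : R := pZY (z, y) * W z x.

(** expected average distortion of a block code of length n with message
    sets 'I_M1 (helper) and 'I_M (encoder) *)
Definition code_distortion (n M1 M : nat)
    (f1 : {ffun 'I_n -> Y} -> 'I_M1)
    (f : {ffun 'I_n -> X} -> 'I_M1 -> 'I_M)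
    (g : 'I_M -> 'I_M1 -> {ffun 'I_n -> Z} -> {ffun 'I_n -> Xh}) : R :=
  \sum_(xs : {ffun 'I_n -> X}) \sum_(ys : {ffun 'I_n -> Y})
   \sum_(zs : {ffun 'I_n -> Z})
    (\prod_(i < n) pXYZ (xs i) (ys i) (zs i)) *
    ((n%:R)^-1 * \sum_(i < n)
        d (xs i) (g (f xs (f1 ys)) (f1 ys) zs i)).

Definition achievable (D Rt R1 : R) : Prop :=
  forall eps : R, 0 < eps ->
  exists N : nat, forall n : nat, (N <= n)%N ->
  exists (M1 M : nat),
    (M1%:R <= powR 2 (n%:R * R1)) /\ (M%:R <= powR 2 (n%:R * Rt)) /\
    exists (f1 : {ffun 'I_n -> Y} -> 'I_M1)
           (f : {ffun 'I_n -> X} -> 'I_M1 -> 'I_M)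
           (g : 'I_M -> 'I_M1 -> {ffun 'I_n -> Z} -> {ffun 'I_n -> Xh}),
      code_distortion f1 f g <= D + eps.

Definition op_region (D Rt R1 : R) : Prop :=
  forall e : R, 0 < e ->
  exists Rt' R1', achievable D Rt' R1' /\ `|Rt - Rt'| < e /\ `|R1 - R1'| < e.

Definition sl_region (D Rt R1 : R) : Prop :=
  exists (U V : finType) (q : Y -> U -> R) (r : X * U -> V -> R)
         (xhat : U -> V -> Z -> Xh),
    is_channel q /\ is_channel r /\
    let P := fun t : X * Y * Z * U * V =>
      let: (x, y, z, u, v) := t in pXYZ x y z * q y u * r (x, u) v in
    \sum_(t : X * Y * Z * U * V)
       P t * (let: (x, y, z, u, v) := t in d x (xhat u v z)) <= D /\
    R1 >= cond_mutual_info P (fun t => t.1.2) (fun t => t.1.1.1.2)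
                             (fun t => t.1.1.1.1) /\
    Rt >= cond_mutual_info P (fun t => t.1.1.1.1) (fun t => t.2)
                             (fun t => (t.1.2, t.1.1.2)).

End WZHelper.

(* Main.v *)
(* Converse.  For a block code put U_i = (T_1, Z^(i-1), X_(i+1)^n).  Since X^i depends
   on everything else only through Z^i, the decoder loses nothing if it replaces its
   future side information Z_(i+1)^n by X_(i+1)^n, so the best reconstruction of X_i
   from (U_i, T, Z_i) is at least as good as the one of the code; V_i is this
   reconstruction, as a function of the value of Z_i.  Chain rules bound the two sums
   of conditional informations by log M_1 and log M.  Caratheodory's theorem bounds the
   alphabet of U, and compactness of the set of channels absorbs the epsilons.

   Achievability.  Two applications of the same random binning argument: the helper
   describes U^n at rate I(U;Y) - I(U;X) = I(U;Y|X), which suffices for the encoder and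
   a fortiori for the decoder as I(U;X) <= I(U;Z); then, for each u^n, the encoder
   describes V^n at rate I(X;V|U) - I(Z;V|U) = I(X;V|U,Z).  The analysis is one-shot
   (soft covering for the encoder, maximum likelihood for the decoders), and the weak
   law of large numbers for the information densities gives the rates. *)

Require Import Defs.
From mathcomp Require Import all_boot all_order all_algebra.
From mathcomp Require Import boolp classical_sets reals topology.
From mathcomp Require Import normedtype exp sequences.
From mathcomp Require Import ring lra.
Set Implicit Arguments. Unset Strict Implicit. Unset Printing Implicit Defensive.
Import Order.TTheory GRing.Theory Num.Theory.
Import numFieldNormedType.Exports.
Local Open Scope classical_set_scope.
Local Open Scope ring_scope.

(** * Random variables on finite measure spaces *)

Definition rv_pair (T TA TB : Type) (A : T -> TA) (B : T -> TB) (t : T) :=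
  (A t, B t).

Notation "[ % A , B , .. , C ]" :=
  (rv_pair .. (rv_pair A B) .. C) (format "[ % A ,  B ,  .. ,  C ]").

Definition function_of (T TA TB : Type) (A : T -> TA) (B : T -> TB) :=
  forall t t', B t = B t' -> A t = A t'.

Ltac rv_congr :=
  rewrite /function_of /rv_pair /=; intros; first [congruence | split; congruence].

Section Law.
Variable R : realType.
Implicit Types T TA TB TC TD I : finType.

Definition expect T (P F : T -> R) : R := \sum_t P t * F t.

Definition prob T (P : T -> R) (E : pred T) : R := \sum_(t | E t) P t.

Definition law T TA (P : T -> R) (A : T -> TA) (a : TA) : R :=
  \sum_(t | A t == a) P t.

Lemma sum_pair TA TB (F : TA * TB -> R) : \sum_w F w = \sum_a \sum_b F (a, b).
Proof. by rewrite pair_bigA; apply: eq_bigr => -[]. Qed.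

Lemma sum_triple TA TB TC (F : TA * TB * TC -> R) :
  \sum_w F w = \sum_a \sum_b \sum_c F (a, b, c).
Proof. by rewrite !sum_pair. Qed.

Lemma pmf_inhabited T (P : T -> R) : is_pmf P -> T.
Proof.
move=> [_ P1]; have [t _|T0] := pickP T; first exact: t.
by exfalso; move: P1; rewrite big_pred0// => /esym/eqP; rewrite oner_eq0.
Qed.

Lemma expect_cst T (P : T -> R) c : is_pmf P -> expect P (fun=> c) = c.
Proof. by move=> [_ P1]; rewrite /expect -mulr_suml P1 mul1r. Qed.

Lemma expectD T (P F G : T -> R) :
  expect P (fun t => F t + G t) = expect P F + expect P G.
Proof. by rewrite -big_split; apply: eq_bigr => t _; rewrite mulrDr. Qed.

Lemma expectN T (P F : T -> R) : expect P (fun t => - F t) = - expect P F.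
Proof. by rewrite -sumrN; apply: eq_bigr => t _; rewrite mulrN. Qed.

Lemma expectB T (P F G : T -> R) :
  expect P (fun t => F t - G t) = expect P F - expect P G.
Proof. by rewrite expectD expectN. Qed.

Lemma expectZ T (P F : T -> R) c :
  expect P (fun t => c * F t) = c * expect P F.
Proof. by rewrite mulr_sumr; apply: eq_bigr => t _; rewrite mulrCA. Qed.

Lemma expect_sum T I (P : T -> R) (F : I -> T -> R) :
  expect P (fun t => \sum_i F i t) = \sum_i expect P (F i).
Proof.
by rewrite exchange_big; apply: eq_bigr => t _; rewrite mulr_sumr.
Qed.

Lemma expect_indic T (P : T -> R) (E : pred T) :
  expect P (fun t => (E t)%:R) = prob P E.
Proof.
rewrite /prob big_mkcond; apply: eq_bigr => t _.
by case: (E t); rewrite ?mulr1 ?mulr0.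
Qed.

Lemma expect_law T TA (P : T -> R) (A : T -> TA) (F : TA -> R) :
  expect (law P A) F = expect P (F \o A).
Proof.
rewrite /expect [RHS](partition_big A xpredT)//=; apply: eq_bigr => a _.
by rewrite mulr_suml; apply: eq_bigr => t /eqP ->.
Qed.

Lemma sum_law T TA (P : T -> R) (A : T -> TA) :
  \sum_a law P A a = \sum_t P t.
Proof. by rewrite /law [RHS](partition_big A xpredT). Qed.

Lemma law_comp T TA TB (P : T -> R) (A : T -> TA) (B : TA -> TB) :
  law (law P A) B =1 law P (B \o A).
Proof.
move=> b; have := expect_law P A (fun a => (B a == b)%:R).
by rewrite !expect_indic.
Qed.

Lemma eq_law T TA TB (P : T -> R) (A : T -> TA) (B : T -> TB) a b :
  (forall t, A t = a <-> B t = b) -> law P A a = law P B b.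
Proof.
by move=> AB; apply: eq_bigl => t; apply/eqP/eqP => [/(AB t).1|/(AB t).2].
Qed.

Lemma law_fiber T TA TB (P : T -> R) (A : T -> TA) (B : T -> TB)
    (e : TB -> T) a :
  (forall b, A (e b) = a) -> cancel e B -> (forall t, A t = a -> e (B t) = t) ->
  law P A a = \sum_b P (e b).
Proof.
move=> Ae eK BK; rewrite /law (reindex e) /=.
  by apply: eq_bigl => b; rewrite Ae eqxx.
by exists B => [b _|t]; [exact: eK | rewrite inE => /eqP/BK].
Qed.

Lemma law_pair_suml T TA TB (P : T -> R) (A : T -> TA) (B : T -> TB) b :
  \sum_a law P [% A, B] (a, b) = law P B b.
Proof.
rewrite /law [RHS](partition_big A xpredT)//=; apply: eq_bigr => a _.
by apply: eq_bigl => t; rewrite xpair_eqE andbC.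
Qed.

Lemma law_triple_suml T TA TB TC (P : T -> R)
    (A : T -> TA) (B : T -> TB) (C : T -> TC) b c :
  \sum_a law P [% A, B, C] (a, b, c) = law P [% B, C] (b, c).
Proof.
rewrite -(law_pair_suml P A); apply: eq_bigr => a _.
by apply: eq_law; rv_congr.
Qed.

Lemma law_triple_summ T TA TB TC (P : T -> R)
    (A : T -> TA) (B : T -> TB) (C : T -> TC) a c :
  \sum_b law P [% A, B, C] (a, b, c) = law P [% A, C] (a, c).
Proof.
rewrite -(law_pair_suml P B); apply: eq_bigr => b _.
by apply: eq_law; rv_congr.
Qed.

Lemma law_triple_compm T TA TB TC TD (P : T -> R)
    (A : T -> TA) (B : T -> TB) (C : T -> TC) (f : TB -> TD) a d c :
  law P [% A, f \o B, C] (a, d, c) =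
  \sum_(b | f b == d) law P [% A, B, C] (a, b, c).
Proof.
rewrite /law (partition_big B (fun b => f b == d)) => [|t]; last first.
  by rewrite !xpair_eqE => /andP[/andP[]].
apply: eq_bigr => b /eqP fb; apply: eq_bigl => t; rewrite !xpair_eqE /=.
by case: (eqVneq (B t) b) => [->|_]; rewrite ?fb ?eqxx ?andbT ?andbF.
Qed.

Section NonNegative.
Variables (T : finType) (P : T -> R).
Hypothesis P_ge0 : forall t, 0 <= P t.

Lemma ler_expect (F G : T -> R) :
  (forall t, F t <= G t) -> expect P F <= expect P G.
Proof. by move=> FG; apply: ler_sum => t _; apply: ler_wpM2l. Qed.

Lemma expect_ge0 (F : T -> R) : (forall t, 0 <= F t) -> 0 <= expect P F.
Proof. by move=> F0; apply: sumr_ge0 => t _; rewrite mulr_ge0. Qed.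

Lemma eq_expect (F G : T -> R) :
  (forall t, 0 < P t -> F t = G t) -> expect P F = expect P G.
Proof.
move=> FG; apply: eq_bigr => t _; have := P_ge0 t; rewrite le_eqVlt.
by case/predU1P => [<-|/FG ->//]; rewrite !mul0r.
Qed.

Lemma le_prob (E F : pred T) :
  (forall t, 0 < P t -> E t -> F t) -> prob P E <= prob P F.
Proof.
move=> EF; rewrite /prob big_mkcond [leRHS]big_mkcond; apply: ler_sum => t _.
have := P_ge0 t; rewrite le_eqVlt => /predU1P[<-|/EF]; first by rewrite !if_same.
by case: (E t) => [->//|_]; case: ifP.
Qed.

Variables (TA TB : finType) (A : T -> TA) (B : T -> TB).

Lemma law_ge0 a : 0 <= law P A a.
Proof. exact: sumr_ge0. Qed.

Lemma law_gt0 t : 0 < P t -> 0 < law P A (A t).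
Proof.
by move=> Pt; rewrite /law (bigD1 t)//= ltr_wpDr// sumr_ge0.
Qed.

Lemma law_le a b : (forall t, B t = b -> A t = a) -> law P B b <= law P A a.
Proof. by move=> BA; apply: le_prob => t _ /eqP/BA/eqP. Qed.

End NonNegative.

Lemma law_pmf T TA (P : T -> R) (A : T -> TA) : is_pmf P -> is_pmf (law P A).
Proof.
by move=> [P0 P1]; split; [exact: law_ge0 | rewrite sum_law].
Qed.

Lemma exists_le_expect T (P F : T -> R) b :
  is_pmf P -> expect P F <= b -> exists t, F t <= b.
Proof.
move=> Ppmf; apply: contraPP => /forallNP Fb; apply/negP; rewrite -ltNge.
have [P0 P1] := Ppmf.
have {}Fb t : 0 < F t - b by rewrite subr_gt0 ltNge; apply/negP/Fb.
rewrite -subr_gt0 -(expect_cst b Ppmf) -expectB lt_neqAle eq_sym.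
rewrite expect_ge0// ?andbT => [|t]; last exact: ltW.
apply/negP; rewrite psumr_eq0 => [/allP PF0|t _]; last by rewrite mulr_ge0// ltW.
suff: \sum_t P t = 0 by move/eqP; rewrite P1 oner_eq0.
apply: big1 => t _; have := PF0 t (mem_index_enum t).
by rewrite mulf_eq0 (gt_eqF (Fb t)) orbF => /eqP.
Qed.

End Law.

(** * Entropy and conditional information *)

Section Gibbs.
Variable R : realType.

Lemma ln_leif (x : R) : 0 < x -> ln x <= x - 1 ?= iff (x == 1).
Proof.
move=> x0; have lnx : ln x <= x - 1.
  by have := @le_ln1Dx R (x - 1); rewrite (addrC 1) subrK; apply; lra.
split=> //; apply/eqP/eqP => [e|->]; last by rewrite ln1 subrr.
apply/eqP; rewrite -ln_eq0//; apply/negPn/negP => /expR_gt1Dx.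
by rewrite lnK ?posrE// e; lra.
Qed.

Lemma relative_entropy_leif (p q : R) : 0 <= p -> 0 <= q -> (0 < p -> 0 < q) ->
  p - q <= p * (ln p - ln q) ?= iff (p == q).
Proof.
rewrite le_eqVlt => /predU1P[<- q0 _|p0 q0 /(_ p0) {}q0].
  by rewrite mul0r sub0r; split; rewrite ?oppr_le0// oppr_eq0 eq_sym.
have [le_ln eq_ln] := ln_leif (divr_gt0 q0 p0).
have pE : p * (q / p - 1) = q - p by field; rewrite gt_eqF.
have -> : p * (ln p - ln q) = - (p * ln (q / p)).
  by rewrite ln_div ?posrE//; ring.
have -> : p - q = - (p * (q / p - 1)) by rewrite pE opprB.
split; first by rewrite lerN2 ler_wpM2l// ltW.
have p_neq0 : p != 0 by rewrite gt_eqF.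
rewrite eqr_opp (inj_eq (mulfI p_neq0)) eq_sym eq_ln.
by rewrite -(inj_eq (mulIf p_neq0)) divfK// mul1r eq_sym.
Qed.

Lemma gibbs (I : finType) (p q : I -> R) :
  (forall i, 0 <= p i) -> (forall i, 0 <= q i) ->
  (forall i, 0 < p i -> 0 < q i) -> \sum_i q i = \sum_i p i ->
  0 <= \sum_i p i * (ln (p i) - ln (q i)) ?= iff [forall i, p i == q i].
Proof.
move=> p0 q0 pq e.
suff : \sum_i (p i - q i) <= \sum_i p i * (ln (p i) - ln (q i))
    ?= iff [forall i, p i == q i] by rewrite sumrB e subrr.
by apply: leif_sum => i _; apply: relative_entropy_leif (p0 i) (q0 i) (pq i).
Qed.

End Gibbs.

Section Entropy.
Variable R : realType.
Implicit Types T TA TB TC TD : finType.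

(* In nats; [ln 0 = 0] is harmless, since [law P A (A t)] vanishes only where
   [P t] does. *)
Definition entropy T TA (P : T -> R) (A : T -> TA) : R :=
  expect P (fun t => - ln (law P A (A t))).

Definition cond_entropy T TA TC (P : T -> R) (A : T -> TA) (C : T -> TC) : R :=
  entropy P [% A, C] - entropy P C.

Definition info_density T TA TB TC (P : T -> R)
    (A : T -> TA) (B : T -> TB) (C : T -> TC) (t : T) : R :=
  ln (law P [% A, B, C] ([% A, B, C] t)) + ln (law P C (C t))
  - ln (law P [% A, C] ([% A, C] t)) - ln (law P [% B, C] ([% B, C] t)).

Definition cond_info T TA TB TC (P : T -> R)
    (A : T -> TA) (B : T -> TB) (C : T -> TC) : R :=
  expect P (info_density P A B C).

Definition cond_indep T TA TB TC (P : T -> R)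
    (A : T -> TA) (B : T -> TB) (C : T -> TC) : Prop :=
  forall a b c, law P [% A, B, C] (a, b, c) * law P C c =
                law P [% A, C] (a, c) * law P [% B, C] (b, c).

Lemma cond_infoE T TA TB TC (P : T -> R)
    (A : T -> TA) (B : T -> TB) (C : T -> TC) :
  cond_info P A B C = entropy P [% A, C] + entropy P [% B, C]
                      - entropy P [% A, B, C] - entropy P C.
Proof.
rewrite /entropy -expectD -!expectB; apply: eq_bigr => t _.
by rewrite /info_density; congr (_ * _); ring.
Qed.

Lemma entropy_eq T TA TB (P : T -> R) (A : T -> TA) (B : T -> TB) :
  function_of A B -> function_of B A -> entropy P A = entropy P B.
Proof.
move=> AB BA; apply: eq_bigr => t _; congr (_ * - ln _).
by apply: eq_law => t'; split=> [/BA|/AB].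
Qed.

Lemma cond_infoC T TA TB TC (P : T -> R)
    (A : T -> TA) (B : T -> TB) (C : T -> TC) :
  cond_info P A B C = cond_info P B A C.
Proof.
rewrite !cond_infoE [_ + entropy P [% B, C]]addrC; congr (_ - _ - _).
by apply: entropy_eq; rv_congr.
Qed.

Lemma cond_info_entropy T TA TB TC (P : T -> R)
    (A : T -> TA) (B : T -> TB) (C : T -> TC) :
  cond_info P A B C = cond_entropy P B C - cond_entropy P B [% C, A].
Proof.
rewrite cond_infoE /cond_entropy.
have -> : entropy P [% A, B, C] = entropy P [% B, [% C, A]].
  by apply: entropy_eq; rv_congr.
have -> : entropy P [% A, C] = entropy P [% C, A] by apply: entropy_eq; rv_congr.
by lra.
Qed.

Lemma eq_cond_info T TA TB TC TD (P : T -> R)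
    (A : T -> TA) (B : T -> TB) (C : T -> TC) (D : T -> TD) :
  function_of C D -> function_of D C -> cond_info P A B C = cond_info P A B D.
Proof.
move=> CD DC; have pairE (TA' : finType) (A' : T -> TA') :
    entropy P [% A', C] = entropy P [% A', D].
  by apply: entropy_eq => t t' [eA e]; rewrite /rv_pair eA ?(CD _ _ e) ?(DC _ _ e).
by rewrite !cond_infoE !pairE (entropy_eq P CD DC).
Qed.

Lemma entropy_law T TA TB (P : T -> R) (A : T -> TA) (B : TA -> TB) :
  entropy (law P A) B = entropy P (B \o A).
Proof.
rewrite /entropy expect_law; apply: eq_bigr => t _ /=.
by rewrite law_comp.
Qed.

Lemma cond_entropy_law T (S : finType) TA TC (P : T -> R) (F : T -> S)
    (A : S -> TA) (C : S -> TC) :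
  cond_entropy (law P F) A C = cond_entropy P (A \o F) (C \o F).
Proof. by rewrite /cond_entropy !entropy_law. Qed.

Lemma cond_info_law T (S : finType) TA TB TC (P : T -> R) (F : T -> S)
    (A : S -> TA) (B : S -> TB) (C : S -> TC) :
  cond_info (law P F) A B C = cond_info P (A \o F) (B \o F) (C \o F).
Proof. by rewrite !cond_infoE !entropy_law. Qed.

Lemma cond_indep_factor T TA TB TC (P : T -> R) (A : T -> TA) (B : T -> TB)
    (C : T -> TC) (F : TA -> TC -> R) (G : TB -> TC -> R) :
  (forall a b c, law P [% A, B, C] (a, b, c) = F a c * G b c) ->
  cond_indep P A B C.
Proof.
move=> lawE a b c.
have lawAC a' : law P [% A, C] (a', c) = F a' c * \sum_b' G b' c.
  rewrite -(law_triple_summ P A B C) mulr_sumr.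
  by apply: eq_bigr => b' _; rewrite lawE.
have -> : law P [% B, C] (b, c) = (\sum_a' F a' c) * G b c.
  rewrite -(law_triple_suml P A B C) mulr_suml.
  by apply: eq_bigr => a' _; rewrite lawE.
have -> : law P C c = (\sum_a' F a' c) * \sum_b' G b' c.
  by rewrite -(law_pair_suml P A C) mulr_suml; apply: eq_bigr => a' _.
by rewrite lawE lawAC; ring.
Qed.

(* The restriction of [P] to the event [C = c], not normalised. *)
Definition slice T TC (P : T -> R) (C : T -> TC) (c : TC) (t : T) : R :=
  if C t == c then P t else 0.

Lemma law_slice T TA TC (P : T -> R) (A : T -> TA) (C : T -> TC) a c :
  law (slice P C c) A a = law P [% A, C] (a, c).
Proof.
rewrite /law -big_mkcondr; apply: eq_bigl => t.
by rewrite xpair_eqE andbC.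
Qed.

Lemma entropy_slices T TA TC (P : T -> R) (A : T -> TA) (C : T -> TC) :
  entropy P [% A, C] = \sum_c entropy (slice P C c) A.
Proof.
rewrite /entropy /expect (partition_big C xpredT)//=; apply: eq_bigr => c _.
rewrite big_mkcond; apply: eq_bigr => t _; rewrite law_slice /slice.
by case: eqP => [<-|_]; rewrite ?mul0r.
Qed.

Lemma cond_entropy_slices T TA TC TD (P : T -> R)
    (A : T -> TA) (C : T -> TC) (D : T -> TD) :
  cond_entropy P A [% C, D] = \sum_d cond_entropy (slice P D d) A C.
Proof.
rewrite /cond_entropy sumrB -!entropy_slices; congr (_ - _).
by apply: entropy_eq; rv_congr.
Qed.

Lemma cond_info_slices T TA TB TC TD (P : T -> R)
    (A : T -> TA) (B : T -> TB) (C : T -> TC) (D : T -> TD) :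
  cond_info P A B [% C, D] = \sum_d cond_info (slice P D d) A B C.
Proof.
under eq_bigr do rewrite cond_infoE.
rewrite !sumrB big_split -!entropy_slices cond_infoE /=.
by congr (_ + _ - _ - _); apply: entropy_eq; rv_congr.
Qed.

Section NonNegative.
Variables (T : finType) (P : T -> R).
Hypothesis P_ge0 : forall t, 0 <= P t.

Lemma entropyZ TA (A : T -> TA) c : 0 <= c ->
  entropy (fun t => c * P t) A = c * entropy P A - c * ln c * \sum_t P t.
Proof.
move=> c0; have lawZ a : law (fun t => c * P t) A a = c * law P A a.
  by rewrite /law -mulr_sumr.
rewrite /entropy /expect !mulr_sumr -sumrB; apply: eq_bigr => t _.
have [->|cn0] := eqVneq c 0; first by rewrite !mul0r subrr.
have := P_ge0 t; rewrite le_eqVlt => /predU1P[<-|Pt].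
  by rewrite !(mulr0, mul0r) subrr.
by rewrite lawZ lnM ?posrE ?law_gt0// ?lt_def ?cn0//; ring.
Qed.

Lemma cond_entropyZ TA TC (A : T -> TA) (C : T -> TC) c : 0 <= c ->
  cond_entropy (fun t => c * P t) A C = c * cond_entropy P A C.
Proof. by move=> c0; rewrite /cond_entropy !entropyZ//; ring. Qed.

Lemma cond_infoZ TA TB TC (A : T -> TA) (B : T -> TB) (C : T -> TC) c : 0 <= c ->
  cond_info (fun t => c * P t) A B C = c * cond_info P A B C.
Proof. by move=> c0; rewrite !cond_infoE !entropyZ//; ring. Qed.

Lemma entropy_le TA TB (A : T -> TA) (B : T -> TB) :
  function_of A B -> entropy P A <= entropy P B.
Proof.
move=> AB; apply: ler_sum => t _.
have := P_ge0 t; rewrite le_eqVlt => /predU1P[<-|Pt]; first by rewrite !mul0r.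
rewrite ler_wpM2l// lerN2 ler_ln ?posrE ?law_gt0//.
by apply: law_le => // t' /AB.
Qed.

Section CondInfo.
Variables (TA TB TC : finType) (A : T -> TA) (B : T -> TB) (C : T -> TC).

Let joint_law w := law P [% A, B, C] w.
Let product_law (w : TA * TB * TC) :=
  law P [% A, C] (w.1.1, w.2) * law P [% B, C] (w.1.2, w.2) / law P C w.2.

Let le_AC w : joint_law w <= law P [% A, C] (w.1.1, w.2).
Proof. by apply: law_le => // t <-. Qed.

Let le_BC w : joint_law w <= law P [% B, C] (w.1.2, w.2).
Proof. by apply: law_le => // t <-. Qed.

Let le_C w : joint_law w <= law P C w.2.
Proof. by apply: law_le => // t <-. Qed.

Let product_law_gt0 w : 0 < joint_law w -> 0 < product_law w.
Proof.
move=> w0; rewrite /product_law divr_gt0 ?mulr_gt0//; apply: (lt_le_trans w0).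
- exact: le_AC.
- exact: le_BC.
- exact: le_C.
Qed.

Let sum_product_law : \sum_w product_law w = \sum_w joint_law w.
Proof.
rewrite sum_law -(sum_law P C) sum_pair exchange_big /=; apply: eq_bigr => c _.
rewrite sum_pair /product_law /=.
under eq_bigr => a _ do rewrite -mulr_suml -mulr_sumr law_pair_suml.
rewrite -!mulr_suml law_pair_suml.
by have [->|c0] := eqVneq (law P C c) 0; rewrite ?mul0r ?mulfK.
Qed.

Let density_law : cond_info P A B C =
  \sum_w joint_law w * (ln (joint_law w) - ln (product_law w)).
Proof.
transitivity (expect joint_law (fun w => ln (joint_law w) + ln (law P C w.2)
    - ln (law P [% A, C] (w.1.1, w.2)) - ln (law P [% B, C] (w.1.2, w.2)))).
  by rewrite expect_law.
apply: eq_expect => [w|w w0]; first exact: law_ge0.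
have AC := lt_le_trans w0 (le_AC w); have BC := lt_le_trans w0 (le_BC w).
have C0 := lt_le_trans w0 (le_C w).
by rewrite [in RHS]/product_law ln_div ?lnM ?posrE ?mulr_gt0//; ring.
Qed.

Let product_lawE w : (joint_law w == product_law w) =
  (joint_law w * law P C w.2 ==
   law P [% A, C] (w.1.1, w.2) * law P [% B, C] (w.1.2, w.2)).
Proof.
have [C0|C0] := eqVneq (law P C w.2) 0; last first.
  by rewrite /product_law -(inj_eq (mulIf C0)) divfK.
have := le_C w; have := law_le P_ge0 (A := C) (B := [% A, C]) (a := w.2)
  (b := (w.1.1, w.2)).
rewrite /product_law C0 invr0 !mulr0 => AC0 w0.
have -> : joint_law w = 0 by apply: le_anti; rewrite w0 law_ge0.
suff -> : law P [% A, C] (w.1.1, w.2) = 0 by rewrite mul0r.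
by apply: le_anti; rewrite law_ge0// AC0// => t [].
Qed.

Lemma cond_info_leif :
  0 <= cond_info P A B C ?= iff [forall w, joint_law w == product_law w].
Proof.
rewrite density_law; apply: gibbs => // w; first exact: law_ge0.
by rewrite divr_ge0 ?mulr_ge0 ?law_ge0.
Qed.

Lemma cond_info_ge0 : 0 <= cond_info P A B C.
Proof. by case: cond_info_leif. Qed.

Lemma cond_info_eq0 : cond_info P A B C = 0 <-> cond_indep P A B C.
Proof.
split=> [e a b c|indep].
  apply/eqP; have := cond_info_leif.2; rewrite e eqxx => /esym/forallP.
  by move=> /(_ (a, b, c)); rewrite product_lawE.
apply/esym/eqP; rewrite cond_info_leif.2; apply/forallP => -[[a b] c].
by rewrite product_lawE /= indep.
Qed.

Lemma cond_mutual_infoE : cond_mutual_info P A B C * ln 2 = cond_info P A B C.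
Proof.
have ln2 : ln 2 != 0 :> R by rewrite gt_eqF// ln_gt0// ltr1n.
rewrite density_law sum_triple.
rewrite mulr_suml; apply: eq_bigr => a _; rewrite mulr_suml; apply: eq_bigr => b _.
rewrite mulr_suml; apply: eq_bigr => c _.
rewrite /= -/(law P [% A, B, C] (a, b, c)) -/(joint_law (a, b, c)).
rewrite -/(law P [% A, C] (a, c)) -/(law P [% B, C] (b, c)) -/(law P C c).
case: ifPn => [w0|]; last first.
  rewrite -leNgt => w0; suff -> : joint_law (a, b, c) = 0 by rewrite !mul0r.
  by apply: le_anti; rewrite w0 law_ge0.
rewrite /log2 -mulrA divfK// /product_law /=; congr (_ * _).
have /= AC := lt_le_trans w0 (le_AC _); have /= BC := lt_le_trans w0 (le_BC _).
have /= C0 := lt_le_trans w0 (le_C _).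
by rewrite !(ln_div, lnM) ?posrE ?mulr_gt0//; ring.
Qed.

End CondInfo.

End NonNegative.
End Entropy.

(** * Shannon inequalities and conditional laws *)

Section Shannon.
Variables (R : realType) (T : finType) (P : T -> R).
Hypothesis P_ge0 : forall t, 0 <= P t.
Implicit Types TA TB TC TD TJ TK TM : finType.

Lemma entropy_absorb TA TB (A : T -> TA) (B : T -> TB) :
  function_of B A -> entropy P [% A, B] = entropy P A.
Proof.
move=> BA; apply: entropy_eq => [t t' e|t t' []//].
by rewrite /rv_pair e (BA t t' e).
Qed.

Lemma entropy_submod TA TB TJ TM
    (A : T -> TA) (B : T -> TB) (J : T -> TJ) (M : T -> TM) :
  function_of J [% A, B] -> function_of M A -> function_of M B ->
  entropy P J + entropy P M <= entropy P A + entropy P B.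
Proof.
move=> JAB MA MB; have := cond_info_ge0 P_ge0 A B M; rewrite cond_infoE.
rewrite (entropy_absorb MA) (entropy_absorb MB).
suff : entropy P J <= entropy P [% A, B, M] by lra.
by apply: entropy_le => // t t' [eA eB _]; apply: JAB; rewrite /rv_pair eA eB.
Qed.

Lemma cond_indep_entropy TA TB TC (A : T -> TA) (B : T -> TB) (C : T -> TC) :
  cond_indep P A B C <->
  entropy P [% A, C] + entropy P [% B, C] =
    entropy P [% A, B, C] + entropy P C.
Proof. by rewrite -cond_info_eq0// cond_infoE; split=> ?; lra. Qed.

Lemma cond_indepC TA TB TC (A : T -> TA) (B : T -> TB) (C : T -> TC) :
  cond_indep P A B C -> cond_indep P B A C.
Proof. by rewrite -!cond_info_eq0// cond_infoC. Qed.

Lemma function_cond_indep TA TB TC (A : T -> TA) (B : T -> TB) (C : T -> TC) :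
  function_of A C -> cond_indep P A B C.
Proof.
move=> AC; apply/cond_indep_entropy; rewrite addrC; congr (_ + _).
  apply: entropy_eq => t t'; rewrite /rv_pair; first by case=> _ -> ->.
  by case=> -> e; rewrite (AC t t' e) e.
apply: entropy_eq => [t t' e|t t' []//].
by rewrite /rv_pair e (AC t t' e).
Qed.

Lemma cond_indepW TA TB TC TD (A : T -> TA) (B : T -> TB) (C : T -> TC)
    (D : T -> TD) (TA' TB' : finType) (A' : T -> TA') (B' : T -> TB') :
  cond_indep P A B C -> function_of C D -> function_of D [% B, C] ->
  function_of A' [% A, D] -> function_of B' [% B, C] -> cond_indep P A' B' D.
Proof.
move=> /cond_indep_entropy indep CD DBC A'AD B'BC; apply/cond_indep_entropy.
apply: le_anti; apply/andP; split; last first.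
  by have := cond_info_ge0 P_ge0 A' B' D; rewrite cond_infoE; lra.
have refine_D : entropy P [% A, D] + entropy P C <= entropy P [% A, C] + entropy P D.
  by apply: entropy_submod => // [|t t' []//]; rv_congr.
have drop_A : entropy P [% A, B, C] + entropy P [% A', D]
    <= entropy P [% A, D] + entropy P [% A', [% B, C]].
  apply: entropy_submod => t t'; rewrite /rv_pair.
  - by case=> -> _ _ -> ->.
  - by move=> e; rewrite (A'AD t t' e); case: e => _ ->.
  - by case=> -> eB eC; rewrite (DBC t t')// /rv_pair eB eC.
have drop_B : entropy P [% A', [% B, C]] + entropy P [% B', D]
    <= entropy P [% A', B', D] + entropy P [% B, C].
  apply: entropy_submod => t t'; rewrite /rv_pair.
  - by case=> -> _ _ -> ->.
  - by case=> _ -> ->.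
  - by move=> e; rewrite (B'BC t t' e) (DBC t t' e).
lra.
Qed.

Lemma cond_info_chain TA TB TC TD (A : T -> TA) (B : T -> TB) (C : T -> TC)
    (D : T -> TD) : cond_indep P A C [% B, D] ->
  cond_info P A B [% C, D] = cond_info P A B D - cond_info P A C D.
Proof.
move=> /cond_indep_entropy; rewrite !cond_infoE.
have -> : entropy P [% A, [% B, D]] = entropy P [% A, B, D].
  by apply: entropy_eq; rv_congr.
have -> : entropy P [% C, [% B, D]] = entropy P [% B, [% C, D]].
  by apply: entropy_eq; rv_congr.
have -> : entropy P [% A, [% C, D]] = entropy P [% A, C, D].
  by apply: entropy_eq; rv_congr.
have -> : entropy P [% A, C, [% B, D]] = entropy P [% A, B, [% C, D]].
  by apply: entropy_eq; rv_congr.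
lra.
Qed.

Lemma data_processing TA TB TC TD (A : T -> TA) (B : T -> TB) (C : T -> TC)
    (D : T -> TD) : cond_indep P A C [% B, D] ->
  cond_info P A C D <= cond_info P A B D.
Proof.
by move/cond_info_chain => e; rewrite -subr_ge0 -e cond_info_ge0.
Qed.

Lemma cond_entropy_ge0 TA TC (A : T -> TA) (C : T -> TC) : 0 <= cond_entropy P A C.
Proof. by rewrite subr_ge0; apply: entropy_le => // t t' []. Qed.

Lemma cond_entropy_mono TA TC TD (A : T -> TA) (C : T -> TC) (D : T -> TD) :
  function_of D C -> cond_entropy P A C <= cond_entropy P A D.
Proof.
move=> DC; have : entropy P [% A, C] + entropy P D <= entropy P [% A, D] + entropy P C.
  by apply: entropy_submod => // [|t t' []//]; rv_congr.
by rewrite /cond_entropy; lra.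
Qed.

(* The data processing inequality [I(A;B|C) <= I(A;[T,K]|C) = I(A;T|K)]. *)
Lemma cond_info_le_entropy_drop TA TB TC TK TK' TM
    (A : T -> TA) (B : T -> TB) (C : T -> TC) (K : T -> TK) (K' : T -> TK')
    (M : T -> TM) :
  cond_indep P A K C -> function_of C K -> function_of B [% M, K] ->
  function_of [% A, K] K' ->
  cond_info P A B C <= cond_entropy P M K - cond_entropy P M K'.
Proof.
move=> indep CK BMK AKK'.
have le_AK : cond_entropy P M K' <= cond_entropy P M [% A, K].
  exact: cond_entropy_mono.
have : entropy P [% A, M, K] + entropy P [% B, C] <=
    entropy P [% A, B, C] + entropy P [% M, K].
  apply: entropy_submod => t t'; rewrite /rv_pair.
  - by case=> -> _ _ -> ->.
  - by case=> _ -> ->.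
  - by move=> e; rewrite (BMK t t' e) (CK t t')//; case: e.
have eq_AMK : entropy P [% A, M, K] = entropy P [% M, [% A, K]].
  by apply: entropy_eq; rv_congr.
have eq_AKC : entropy P [% A, K, C] = entropy P [% A, K].
  by apply: entropy_absorb => t t' [_ /CK].
have eq_KC : entropy P [% K, C] = entropy P K by apply: entropy_absorb.
move/cond_indep_entropy: indep; rewrite cond_infoE eq_AKC eq_KC.
by move: le_AK; rewrite /cond_entropy eq_AMK; lra.
Qed.

End Shannon.

Section Probability.
Variables (R : realType) (T : finType) (P : T -> R).
Hypothesis P_pmf : is_pmf P.
Let P_ge0 := P_pmf.1.

Lemma entropy_le_ln_card (TA : finType) (A : T -> TA) :
  entropy P A <= ln #|TA|%:R.
Proof.
have TA_gt0 : 0 < #|TA|%:R :> R.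
  by rewrite ltr0n; apply/card_gt0P; exists (A (pmf_inhabited P_pmf)).
have lawA := law_pmf A P_pmf.
have [||||+ _] := gibbs (p := law P A) (q := fun=> #|TA|%:R^-1).
- exact: lawA.1.
- by move=> _; rewrite invr_ge0 ltW.
- by move=> _ _; rewrite invr_gt0.
- by rewrite sumr_const -[_ *+ _]mulr_natr mulVf ?gt_eqF// lawA.2.
rewrite -/(expect (law P A) _) expectB expect_cst// expect_law lnV ?posrE//.
by rewrite /entropy expectN; lra.
Qed.

Lemma entropy_cst (TA : finType) (A : T -> TA) :
  (forall t t', A t = A t') -> entropy P A = 0.
Proof.
move=> cstA; apply: big1 => t _; suff -> : law P A (A t) = 1.
  by rewrite ln1 oppr0 mulr0.
by rewrite -P_pmf.2; apply: eq_bigl => t'; rewrite (cstA t' t) eqxx.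
Qed.

Lemma cond_entropy_le (TA TC : finType) (A : T -> TA) (C : T -> TC) :
  cond_entropy P A C <= entropy P A.
Proof.
have : entropy P [% A, C] + entropy P (fun=> tt) <= entropy P A + entropy P C.
  exact: entropy_submod.
by rewrite (entropy_cst (A := fun=> tt))// /cond_entropy; lra.
Qed.

Section CondLaw.
Variables (TA TC : finType) (A : T -> TA) (C : T -> TC).

(* The unconditional law on null events makes this a channel. *)
Definition cond_law (c : TC) (a : TA) : R :=
  if law P C c == 0 then law P A a else law P [% A, C] (a, c) / law P C c.

Lemma cond_law_channel : is_channel cond_law.
Proof.
move=> c; rewrite /cond_law; case: eqP => [_|/eqP C0]; first exact: law_pmf.
split=> [a|]; first by rewrite divr_ge0 ?law_ge0.
by rewrite -mulr_suml law_pair_suml divff.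
Qed.

Lemma cond_lawE a c : law P C c * cond_law c a = law P [% A, C] (a, c).
Proof.
rewrite /cond_law; case: eqP => [C0|/eqP C0]; last by rewrite mulrC divfK.
rewrite C0 mul0r; apply/esym/le_anti; rewrite law_ge0// andbT -C0.
by apply: law_le => // t [].
Qed.

End CondLaw.

Lemma cond_indep_law (TA TB TC : finType)
    (A : T -> TA) (B : T -> TB) (C : T -> TC) a b c :
  cond_indep P A B C ->
  law P [% A, B, C] (a, b, c) = law P [% A, C] (a, c) * cond_law B C c b.
Proof.
move=> /(_ a b c); rewrite -!cond_lawE.
have [C0 _|C0 e] := eqVneq (law P C c) 0; last first.
  by apply: (mulIf C0); rewrite e; ring.
suff null (D : finType) (F : T -> D) x : (forall t, F t = x -> C t = c) ->
    law P F x = 0 by rewrite !null ?mul0r// => t [].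
by move=> Fc; apply: le_anti; rewrite law_ge0// andbT -C0; apply: law_le.
Qed.

End Probability.

(** * Product measures *)

Section Product.
Variable R : realType.
Implicit Types I T TA TB TC : finType.

Lemma ln_prod I (F : I -> R) : (forall i, 0 < F i) ->
  ln (\prod_i F i) = \sum_i ln (F i).
Proof.
move=> F0; suff [] : 0 < \prod_i F i /\ ln (\prod_i F i) = \sum_i ln (F i) by [].
elim/big_rec2: _ => [|i x y _ [y0 <-]]; first by rewrite ltr01 ln1.
by rewrite mulr_gt0 ?F0// lnM ?posrE.
Qed.

Definition iid I (T : Type) (p : T -> R) (w : {ffun I -> T}) : R :=
  \prod_i p (w i).

Definition rv_family I (T TA : Type) (A : I -> T -> TA) (w : {ffun I -> T}) :
  {ffun I -> TA} := [ffun i => A i (w i)].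

Definition rv_seq I (T TA : Type) (A : T -> TA) : {ffun I -> T} -> {ffun I -> TA} :=
  rv_family (fun=> A).

Lemma rv_familyP I (T TA : Type) (A : I -> T -> TA) (w : {ffun I -> T}) a :
  rv_family A w = a <-> forall i, A i (w i) = a i.
Proof.
by split=> [<- i|Aw]; [rewrite ffunE | apply/ffunP => i; rewrite ffunE].
Qed.

Lemma rv_seqP I (T TA : Type) (A : T -> TA) (w w' : {ffun I -> T}) :
  rv_seq A w = rv_seq A w' <-> forall i, A (w i) = A (w' i).
Proof. by rewrite rv_familyP; split=> e i; have := e i; rewrite ffunE. Qed.

Lemma rv_seq_comp I (T TA TB : Type) (A : T -> TA) (B : TA -> TB) :
  rv_seq B \o rv_seq A = rv_seq (B \o A) :> ({ffun I -> T} -> _).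
Proof. by apply/funext => w; apply/ffunP => i; rewrite !ffunE. Qed.

Lemma rv_seq_pairP I (T TA TB : Type) (A : T -> TA) (B : T -> TB)
    (w w' : {ffun I -> T}) :
  rv_seq [% A, B] w = rv_seq [% A, B] w' <->
  [% rv_seq A, rv_seq B] w = [% rv_seq A, rv_seq B] w'.
Proof.
split=> [/rv_seqP e|[/rv_seqP eA /rv_seqP eB]].
  by congr (_, _); apply/rv_seqP => i; have [] := e i.
by apply/rv_seqP => i; rewrite /rv_pair eA eB.
Qed.

Lemma iid_pmf I T (p : T -> R) : is_pmf p -> is_pmf (iid p : {ffun I -> T} -> R).
Proof.
move=> [p0 p1]; split=> [w|]; first exact: prodr_ge0.
by rewrite -(bigA_distr_bigA (fun (i : I) t => p t)) big1.
Qed.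

Lemma iid_gt0_coord I T (p : T -> R) (w : {ffun I -> T}) :
  (forall t, 0 <= p t) -> 0 < iid p w -> forall i, 0 < p (w i).
Proof.
move=> p0 w0 i; rewrite lt_neqAle p0 andbT eq_sym.
by apply: contraTneq w0 => pi0; rewrite /iid (bigD1 i)//= pi0 mul0r ltxx.
Qed.

Lemma law_iid I T TA TB (p : T -> R) (A : I -> T -> TA) (a : I -> TA)
    (B : {ffun I -> T} -> TB) b :
  (forall w, B w = b <-> forall i, A i (w i) = a i) ->
  law (iid p) B b = \prod_i law p (A i) (a i).
Proof.
move=> BA; rewrite /law (bigA_distr_big_dep (fun i t => A i t == a i)).
apply: eq_bigl => w; apply/eqP/familyP => [/BA Aw i|Aw].
  by rewrite unfold_in; apply/eqP.
by apply/BA => i; apply/eqP; have := Aw i; rewrite unfold_in.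
Qed.

Lemma law_rv_family I T TA (p : T -> R) (A : I -> T -> TA) (a : {ffun I -> TA}) :
  law (iid p) (rv_family A) a = \prod_i law p (A i) (a i).
Proof. by apply: law_iid => w; apply: rv_familyP. Qed.

Lemma law_rv_family2 I T TA TB (p : T -> R) (A : I -> T -> TA) (B : I -> T -> TB)
    (a : {ffun I -> TA}) (b : {ffun I -> TB}) :
  law (iid p) [% rv_family A, rv_family B] (a, b) =
  \prod_i law p [% A i, B i] (a i, b i).
Proof.
apply: (law_iid _ (A := fun i => [% A i, B i])) => w; rewrite /rv_pair.
split=> [[<- <-] i|ABw]; first by rewrite !ffunE.
by congr (_, _); apply/rv_familyP => i; case: (ABw i).
Qed.

Lemma law_rv_family3 I T TA TB TC (p : T -> R)
    (A : I -> T -> TA) (B : I -> T -> TB) (C : I -> T -> TC)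
    (a : {ffun I -> TA}) (b : {ffun I -> TB}) (c : {ffun I -> TC}) :
  law (iid p) [% rv_family A, rv_family B, rv_family C] (a, b, c) =
  \prod_i law p [% A i, B i, C i] (a i, b i, c i).
Proof.
apply: (law_iid _ (A := fun i => [% A i, B i, C i])) => w; rewrite /rv_pair.
split=> [[<- <- <-] i|ABCw]; first by rewrite !ffunE.
by congr (_, _, _); apply/rv_familyP => i; case: (ABCw i).
Qed.

Lemma cond_indep_rv_family I T TA TB TC (p : T -> R)
    (A : I -> T -> TA) (B : I -> T -> TB) (C : I -> T -> TC) :
  (forall i, cond_indep p (A i) (B i) (C i)) ->
  cond_indep (iid p) (rv_family A) (rv_family B) (rv_family C).
Proof.
move=> indep a b c; rewrite law_rv_family3 !law_rv_family2 law_rv_family.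
by rewrite -!big_split; apply: eq_bigr => i _ /=; rewrite indep.
Qed.

Lemma cond_indep_rv_seq_pair I T TA TB TC (TD : finType) (p : T -> R)
    (A : T -> TA) (B : T -> TB) (C : T -> TC) (D : T -> TD) :
  (forall t, 0 <= p t) -> cond_indep p A B [% C, D] ->
  cond_indep (iid p) (rv_seq A : {ffun I -> T} -> _) (rv_seq B)
    [% rv_seq C, rv_seq D].
Proof.
move=> p0 indep.
have iid0 (w : {ffun I -> T}) : 0 <= iid p w by apply: prodr_ge0.
apply: (cond_indepW iid0 (cond_indep_rv_family (fun=> indep))) => w w'.
- by move/rv_seq_pairP.
- by case=> _ /rv_seq_pairP.
- by case.
- by case.
Qed.

Lemma info_density_rv_seq I T TA TB TC (p : T -> R)
    (A : T -> TA) (B : T -> TB) (C : T -> TC) (w : {ffun I -> T}) :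
  (forall t, 0 <= p t) -> 0 < iid p w ->
  info_density (iid p) (rv_seq A) (rv_seq B) (rv_seq C) w =
  \sum_i info_density p A B C (w i).
Proof.
move=> p0 /(iid_gt0_coord p0) pw.
rewrite /info_density law_rv_family3 !law_rv_family2 law_rv_family.
rewrite !ln_prod => [|i|i|i|i]; try by rewrite !ffunE; apply: law_gt0.
by rewrite -big_split -!sumrB; apply: eq_bigr => i _; rewrite !ffunE.
Qed.

Section Probability.
Variables (I T : finType) (p : T -> R).
Hypothesis p_pmf : is_pmf p.

Lemma law_iid_coord (j : I) : law (iid p) (fun w : {ffun I -> T} => w j) =1 p.
Proof.
move=> t; pose A i (s : T) := (i != j) || (s == t).
rewrite (law_iid _ (A := A) (a := fun=> true)); last first.
  move=> w; rewrite /A; split=> [<- i|/(_ j)]; last by rewrite eqxx => /eqP.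
  by have [->|//] := eqVneq i j; rewrite eqxx.
rewrite (bigD1 j)//= big1 => [|i ij]; last first.
  by rewrite -p_pmf.2; apply: eq_bigl => s; rewrite /A ij.
rewrite mulr1 /law (big_pred1 t)// => s.
by rewrite /A eqxx /= eqb_id.
Qed.

Lemma expect_iid_coord (j : I) (g : T -> R) :
  expect (iid p) (fun w : {ffun I -> T} => g (w j)) = expect p g.
Proof.
rewrite -[LHS]/(expect _ (g \o fun w : {ffun I -> T} => w j)) -expect_law.
by apply: eq_bigr => t _; rewrite law_iid_coord.
Qed.

Lemma law_iid_coord2 (j k : I) (s t : T) : j != k ->
  law (iid p) [% fun w : {ffun I -> T} => w j, fun w => w k] (s, t) = p s * p t.
Proof.
move=> jk; pose A i (u : T) := ((i != j) || (u == s)) && ((i != k) || (u == t)).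
rewrite (law_iid _ (A := A) (a := fun=> true)); last first.
  move=> w; rewrite /rv_pair /A; split=> [[<- <-] i|Aw].
    by apply/andP; split; [have [->|] := eqVneq i j | have [->|] := eqVneq i k];
      rewrite ?eqxx.
  have := Aw j; have := Aw k; rewrite !eqxx jk eq_sym jk /= andbT.
  by move=> /eqP <- /eqP <-.
rewrite (bigD1 j)//= (bigD1 k) /=; last by rewrite eq_sym.
rewrite big1 => [|i /andP[ij ik]]; last first.
  by rewrite -p_pmf.2; apply: eq_bigl => u; rewrite /A ij ik.
rewrite mulr1 /law (big_pred1 s) => [|u]; last first.
  by rewrite /A eqxx jk /= andbT eqb_id.
rewrite (big_pred1 t)// => u.
by rewrite /A eqxx [k == j]eq_sym jk /= eqb_id.
Qed.

Lemma expect_iid_coord2 (j k : I) (g : T -> T -> R) : j != k ->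
  expect (iid p) (fun w : {ffun I -> T} => g (w j) (w k)) =
  expect p (fun s => expect p (g s)).
Proof.
move=> jk; pose jk_coord := [% fun w : {ffun I -> T} => w j, fun w => w k].
rewrite -[LHS]/(expect _ ((fun st => g st.1 st.2) \o jk_coord)) -expect_law.
rewrite /expect sum_pair; apply: eq_bigr => s _.
rewrite mulr_sumr; apply: eq_bigr => t _.
by rewrite law_iid_coord2// mulrA.
Qed.

Lemma expect_sqr_sum_iid (b : T -> R) : expect p b = 0 ->
  expect (iid p) (fun w : {ffun I -> T} => (\sum_i b (w i)) ^+ 2) =
  #|I|%:R * expect p (fun t => b t ^+ 2).
Proof.
move=> b0; transitivity (\sum_i \sum_j
    expect (iid p) (fun w : {ffun I -> T} => b (w i) * b (w j))).
  under [RHS]eq_bigr => i _ do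
    rewrite -(expect_sum _ (fun j (w : {ffun I -> T}) => b (w i) * b (w j))).
  rewrite -(expect_sum _ (fun i (w : {ffun I -> T}) => \sum_j b (w i) * b (w j))).
  apply: eq_bigr => w _; congr (_ * _).
  by rewrite expr2 mulr_suml; apply: eq_bigr => i _; rewrite mulr_sumr.
rewrite mulr_natl -sumr_const; apply: eq_bigr => i _.
rewrite (bigD1 i)//= big1 => [|j ji].
  by rewrite addr0 (expect_iid_coord i (fun t => b t * b t)).
rewrite (expect_iid_coord2 (j := i) (k := j) (fun s t => b s * b t)) 1?eq_sym//.
by apply: big1 => s _; rewrite expectZ b0 !mulr0.
Qed.

End Probability.

Lemma weak_law_lower_tail T (p f : T -> R) a eps :
  is_pmf p -> a < expect p f -> 0 < eps ->
  \forall n \near \oo,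
    prob (iid p) (fun w : {ffun 'I_n -> T} => \sum_i f (w i) <= n%:R * a) <= eps.
Proof.
move=> p_pmf; set m := expect p f; rewrite -subr_gt0 => d0 eps0.
pose v := expect p (fun t => (f t - m) ^+ 2).
near=> n; have n0 : 0 < n%:R :> R by near: n; exact: nbhs_infty_gtr.
have n_large : v <= n%:R * (eps * (m - a) ^+ 2).
  rewrite -ler_pdivrMr ?mulr_gt0 ?exprn_gt0//.
  by near: n; apply: filterS (nbhs_infty_gtr _) => n /ltW; exact.
have nd0 : 0 < (n%:R * (m - a)) ^+ 2 by rewrite exprn_gt0// mulr_gt0.
have chebyshev : prob (iid p) (fun w : {ffun 'I_n -> T} =>
    \sum_i f (w i) <= n%:R * a) * (n%:R * (m - a)) ^+ 2 <= n%:R * v.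
  have mean0 : expect p (fun t => f t - m) = 0 by rewrite expectB expect_cst// subrr.
  have := expect_sqr_sum_iid 'I_n p_pmf mean0; rewrite card_ord => <-.
  rewrite /prob mulr_suml big_mkcond; apply: ler_sum => w _.
  have w0 := (iid_pmf 'I_n p_pmf).1 w.
  case: ifP => [tail|_]; last by rewrite mulr_ge0// sqr_ge0.
  rewrite ler_wpM2l// sumrB sumr_const card_ord -[m *+ n]mulr_natl -[leRHS]sqrrN.
  have dev : n%:R * (m - a) <= - (\sum_i f (w i) - n%:R * m) by lra.
  by rewrite lerXn2r ?nnegrE// ?(le_trans _ dev) ?mulr_ge0// ltW.
rewrite -(ler_pM2r nd0); apply: le_trans chebyshev _.
by have := ler_wpM2l (ltW n0) n_large; lra.
Unshelve. all: by end_near. Qed.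

End Product.

(** * Random binning *)

Section Moments.
Variables (R : realType) (T : finType) (P : T -> R).
Hypothesis P_pmf : is_pmf P.
Let P_ge0 := P_pmf.1.

Lemma expect_sqr_dev (F : T -> R) :
  expect P (fun t => (F t - expect P F) ^+ 2) =
  expect P (fun t => F t ^+ 2) - expect P F ^+ 2.
Proof.
set m := expect P F.
transitivity (expect P (fun t => F t ^+ 2 - 2 * m * F t + m ^+ 2)).
  by apply: eq_bigr => t _; congr (_ * _); ring.
by rewrite expectD expectB expectZ expect_cst// -/m; ring.
Qed.

Lemma expect_sqr_dev_le (F : T -> R) :
  expect P (fun t => (F t - expect P F) ^+ 2) <= expect P (fun t => F t ^+ 2).
Proof. by rewrite expect_sqr_dev gerBl sqr_ge0. Qed.

Lemma expect_norm_le_sqrt (F : T -> R) :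
  expect P (fun t => `|F t|) <= Num.sqrt (expect P (fun t => F t ^+ 2)).
Proof.
rewrite -[leLHS]ger0_norm ?expect_ge0// -sqrtr_sqr; apply: ler_wsqrtr.
under [leRHS]eq_bigr do rewrite -[F _ ^+ 2]real_normK ?num_real//.
rewrite -subr_ge0 -expect_sqr_dev; apply: expect_ge0 => // t.
exact: sqr_ge0.
Qed.

End Moments.

Section SoftCovering.
Variables (R : realType) (I V : finType) (PV : V -> R).
Hypotheses (PV_pmf : is_pmf PV) (I_gt0 : (0 < #|I|)%N).
Let PV_ge0 := PV_pmf.1.
Let codebook_pmf : is_pmf (iid PV : {ffun I -> V} -> R) := iid_pmf I PV_pmf.

Definition sample_mean (a : V -> R) (c : {ffun I -> V}) : R :=
  #|I|%:R^-1 * \sum_i a (c i).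

Let size_gt0 : 0 < #|I|%:R :> R. Proof. by rewrite ltr0n. Qed.

Lemma sample_mean_deviation (a : V -> R) b : (forall v, 0 <= a v <= b) ->
  expect (iid PV) (fun c => `|expect PV a - sample_mean a c|) <=
  Num.sqrt (b * expect PV a / #|I|%:R).
Proof.
move=> a_itv; set m := expect PV a.
apply: le_trans (expect_norm_le_sqrt codebook_pmf _) _; apply: ler_wsqrtr.
have centred : expect PV (fun v => a v - m) = 0 by rewrite expectB expect_cst// subrr.
have -> : expect (iid PV) (fun c => (m - sample_mean a c) ^+ 2) =
    expect PV (fun v => (a v - m) ^+ 2) / #|I|%:R.
  transitivity (#|I|%:R^-2 * (#|I|%:R * expect PV (fun v => (a v - m) ^+ 2))).
    rewrite -(expect_sqr_sum_iid I PV_pmf centred) -expectZ.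
    apply: eq_bigr => c _; congr (_ * _).
    rewrite sumrB sumr_const -[m *+ _]mulr_natl /sample_mean.
    by field; rewrite gt_eqF.
  by field; rewrite gt_eqF.
rewrite ler_pM2r ?invr_gt0//; apply: le_trans (expect_sqr_dev_le PV_pmf a) _.
rewrite -expectZ; apply: ler_expect => // v; have /andP[a0 ab] := a_itv v.
by rewrite expr2 ler_wpM2r.
Qed.

(* Truncating [a] at [tau] times its mean bounds its second moment. *)
Lemma sample_mean_deficit (a : V -> R) tau : 0 <= tau -> (forall v, 0 <= a v) ->
  expect (iid PV) (fun c => Num.max 0 (expect PV a - sample_mean a c)) <=
  expect PV (fun v => if tau * expect PV a < a v then a v else 0)
  + Num.sqrt (tau / #|I|%:R) * expect PV a.
Proof.
move=> tau0 a0; set m := expect PV a.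
set excess := fun v => if tau * m < a v then a v else 0.
have m0 : 0 <= m by apply: expect_ge0.
have excess0 v : 0 <= excess v by rewrite /excess; case: ifP.
pose a' v := a v - excess v.
have a'_itv v : 0 <= a' v <= tau * m.
  rewrite /a' /excess; case: ltP => [_|am]; first by rewrite subrr lexx mulr_ge0.
  by rewrite subr0 a0.
have m'E : expect PV a' = m - expect PV excess by rewrite expectB.
apply: (@le_trans _ _ (expect (iid PV) (fun c =>
    expect PV excess + `|expect PV a' - sample_mean a' c|))).
  apply: ler_expect => [c|c]; first exact: codebook_pmf.1.
  rewrite ge_max addr_ge0 ?expect_ge0//=.
  have le_mean : sample_mean a' c <= sample_mean a c.
    rewrite /sample_mean ler_pM2l ?invr_gt0//; apply: ler_sum => i _.
    by rewrite gerBl.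
  by have := ler_norm (expect PV a' - sample_mean a' c); rewrite {1}m'E; lra.
rewrite expectD expect_cst// lerD2l; apply: le_trans (sample_mean_deviation a'_itv) _.
rewrite -[m in leRHS]ger0_norm// -sqrtr_sqr -sqrtrM ?divr_ge0//.
apply: ler_wsqrtr; rewrite [leRHS]mulrAC expr2 mulrA ler_pM2r ?invr_gt0//.
by rewrite ler_wpM2l ?mulr_ge0// m'E gerBl expect_ge0.
Qed.

End SoftCovering.

Section Channel.
Variables (R : realType) (V S : finType) (PV : V -> R) (A : V -> S -> R).
Hypotheses (PV_pmf : is_pmf PV) (A_channel : is_channel A).

Definition output (s : S) : R := expect PV (A^~ s).

(* Tails of the likelihood ratio [A v s / output s] under the joint law. *)
Definition density_gt (tau : R) : R :=
  expect PV (fun v => prob (A v) (fun s => tau * output s < A v s)).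

Definition density_le (tau : R) : R :=
  expect PV (fun v => prob (A v) (fun s => A v s <= tau * output s)).

Lemma sum_output : \sum_s output s = 1.
Proof.
rewrite exchange_big -[RHS](expect_cst 1 PV_pmf); apply: eq_bigr => v _.
by rewrite -mulr_sumr (A_channel v).2.
Qed.

Lemma expect_output (F : S -> R) :
  expect output F = expect PV (fun v => expect (A v) F).
Proof.
rewrite /expect; under eq_bigr do rewrite mulr_suml.
rewrite exchange_big; apply: eq_bigr => v _; rewrite mulr_sumr.
by apply: eq_bigr => s _; rewrite mulrA.
Qed.

Lemma soft_covering (I : finType) tau : (0 < #|I|)%N -> 0 <= tau ->
  expect (iid PV) (fun c : {ffun I -> V} =>
    \sum_s Num.max 0 (output s - sample_mean (A^~ s) c)) <=
  density_gt tau + Num.sqrt (tau / #|I|%:R).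
Proof.
move=> I_gt0 tau0; rewrite expect_sum.
have deficit s := sample_mean_deficit PV_pmf I_gt0 tau0 (fun v => (A_channel v).1 s).
apply: le_trans (ler_sum _ (fun s _ => deficit s)) _.
rewrite big_split -mulr_sumr sum_output mulr1 /= -expect_sum lerD2r.
apply: ler_expect => [|v]; first exact: PV_pmf.1.
by rewrite /prob [leRHS]big_mkcond.
Qed.

End Channel.

Section MaximumLikelihood.
Variables (R : realType) (V O : finType) (M K : nat).
Variables (PV : V -> R) (C : V -> O -> R).
Hypotheses (PV_pmf : is_pmf PV) (C_channel : is_channel C) (K_gt0 : (0 < K)%N).
Local Notation codebook := {ffun 'I_M * 'I_K -> V}.
Let C_ge0 v o : 0 <= C v o. Proof. exact: (C_channel v).1. Qed.
Let codebook_pmf : is_pmf (iid PV : codebook -> R) := iid_pmf _ PV_pmf.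

Definition ml_index (c : codebook) (m : 'I_M) (o : O) : 'I_K :=
  [arg max_(k > Ordinal K_gt0) C (c (m, k)) o]%O.

Lemma confusion_le tau (i j : 'I_M * 'I_K) : 0 < tau -> i != j ->
  expect (iid PV) (fun c : codebook =>
    \sum_(o | tau * output PV C o < C (c i) o) C (c j) o) <= tau^-1.
Proof.
move=> tau0 ij; rewrite (expect_iid_coord2 PV_pmf
  (fun v v' => \sum_(o | tau * output PV C o < C v o) C v' o) ij).
rewrite -(expect_cst tau^-1 PV_pmf); apply: ler_expect => [|v]; first exact: PV_pmf.1.
have -> : expect PV (fun v' => \sum_(o | tau * output PV C o < C v o) C v' o) =
    \sum_(o | tau * output PV C o < C v o) output PV C o.
  rewrite /expect; under eq_bigr do rewrite mulr_sumr.
  by rewrite exchange_big.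
rewrite -[leRHS]mulr1 -(C_channel v).2 mulr_sumr big_mkcond.
apply: ler_sum => o _; case: ifP => [/ltW typical|_].
  by rewrite mulrC ler_pdivlMr// mulrC.
by rewrite mulr_ge0// invr_ge0 ltW.
Qed.

Lemma ml_index_union_bound tau (c : codebook) m k :
  prob (C (c (m, k))) (fun o => ml_index c m o != k) <=
  prob (C (c (m, k))) (fun o => C (c (m, k)) o <= tau * output PV C o) +
  \sum_(k' | k' != k)
    \sum_(o | tau * output PV C o < C (c (m, k)) o) C (c (m, k')) o.
Proof.
rewrite exchange_big /prob big_mkcond [X in X + _]big_mkcond /=.
rewrite [X in _ + X]big_mkcond -big_split; apply: ler_sum => o _ /=.
have sum_ge0 : 0 <= \sum_(k' | k' != k) C (c (m, k')) o by apply: sumr_ge0.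
case: ltP => _; last by rewrite addr0; case: ifP.
rewrite add0r; case: ifP => // wrong.
apply: (@le_trans _ _ (C (c (m, ml_index c m o)) o)).
  by rewrite /ml_index; case: arg_maxP => // k' _ /(_ k isT).
by rewrite (bigD1 (ml_index c m o))//= lerDl sumr_ge0.
Qed.

Lemma ml_index_error tau m k : 0 < tau ->
  expect (iid PV) (fun c : codebook =>
    prob (C (c (m, k))) (fun o => ml_index c m o != k)) <=
  density_le PV C tau + K.-1%:R / tau.
Proof.
move=> tau0; apply: le_trans (ler_expect codebook_pmf.1
  (fun c => ml_index_union_bound tau c m k)) _.
rewrite expectD; apply: lerD.
  by rewrite (expect_iid_coord PV_pmf (m, k)
    (fun v => prob (C v) (fun o => C v o <= tau * output PV C o))).
rewrite [leLHS](_ : _ = \sum_(k' | k' != k) expect (iid PV) (fun c : codebook =>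
    \sum_(o | tau * output PV C o < C (c (m, k)) o) C (c (m, k')) o)); last first.
  by rewrite /expect exchange_big; apply: eq_bigr => c _; rewrite mulr_sumr.
rewrite [leRHS](_ : _ = \sum_(k' | k' != k) tau^-1); last first.
  by rewrite sumr_const cardC1 card_ord mulr_natl.
apply: ler_sum => k' k'k; apply: confusion_le => //.
by rewrite xpair_eqE eqxx eq_sym.
Qed.

End MaximumLikelihood.

Section OneShot.
Variables (R : realType) (V S T J : finType) (O : J -> finType) (M K : nat).
Variables (PV : V -> R) (A : V -> S -> R) (B : S -> T -> R).
Variables (o : forall j, T -> O j) (cost : (J -> V) -> S -> T -> R) (dmax : R).
Hypotheses (PV_pmf : is_pmf PV) (A_channel : is_channel A) (B_channel : is_channel B).
Hypothesis dmax_ge0 : 0 <= dmax.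
Hypothesis cost_ge0 : forall vs s t, 0 <= cost vs s t.
Hypothesis cost_le : forall vs s t, cost vs s t <= dmax.
Hypotheses (M_gt0 : (0 < M)%N) (K_gt0 : (0 < K)%N).
Local Notation codebook := {ffun 'I_M * 'I_K -> V}.
Let A_ge0 v s : 0 <= A v s. Proof. exact: (A_channel v).1. Qed.
Let B_ge0 s t : 0 <= B s t. Proof. exact: (B_channel s).1. Qed.

Definition observed j (v : V) (x : O j) : R :=
  expect (A v) (fun s => law (B s) (o j) x).

Lemma expect_observed j v (F : O j -> R) :
  expect (@observed j v) F = expect (A v) (fun s => expect (B s) (F \o o j)).
Proof.
rewrite /expect; under eq_bigr do rewrite mulr_suml.
rewrite exchange_big; apply: eq_bigr => s _ /=.
under eq_bigr do rewrite -mulrA.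
by rewrite -mulr_sumr -[X in _ * X]/(expect _ F) expect_law.
Qed.

Lemma observed_channel j : is_channel (@observed j).
Proof.
move=> v; split=> [x|].
  by apply: expect_ge0 => // s; apply: law_ge0.
rewrite exchange_big -[RHS](expect_cst 1 (A_channel v)); apply: eq_bigr => s _.
by rewrite -mulr_sumr (law_pmf (o j) (B_channel s)).2.
Qed.

Definition decoded (c : codebook) (m : 'I_M) (j : J) (x : O j) : V :=
  c (m, ml_index (@observed j) K_gt0 c m x).

Definition bin_cost (c : codebook) (s : S) (m : 'I_M) : R :=
  expect (B s) (fun t => cost (fun j => decoded c m (o j t)) s t).

Definition best_bin (c : codebook) (s : S) : 'I_M :=
  [arg min_(m < Ordinal M_gt0) bin_cost c s m]%O.

Definition genie_cost (v : V) : R :=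
  expect (A v) (fun s => expect (B s) (cost (fun=> v) s)).

Definition decoding_error (c : codebook) (i : 'I_M * 'I_K) (j : J) : R :=
  prob (observed (c i)) (fun x : O j => ml_index (@observed j) K_gt0 c i.1 x != i.2).

Lemma bin_cost_ge0 c s m : 0 <= bin_cost c s m.
Proof. exact: expect_ge0. Qed.

Lemma bin_cost_le c s m : bin_cost c s m <= dmax.
Proof. by rewrite -(expect_cst dmax (B_channel s)) ler_expect. Qed.

(* The decoders that know the bin [i.1] fail only if one of them picks another
   codeword of that bin. *)
Lemma bin_cost_le_genie (c : codebook) i :
  expect (A (c i)) (fun s => bin_cost c s i.1) <=
  genie_cost (c i) + dmax * \sum_j decoding_error c i j.
Proof.
pose wrong j t := ml_index (@observed j) K_gt0 c i.1 (o j t) != i.2.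
have -> : \sum_j decoding_error c i j =
    expect (A (c i)) (fun s => expect (B s) (fun t => \sum_j (wrong j t)%:R)).
  under eq_bigr do rewrite /decoding_error -expect_indic expect_observed.
  by rewrite -expect_sum; apply: eq_bigr => s _; rewrite expect_sum.
rewrite -expectZ -expectD; apply: ler_expect => // s.
rewrite -expectZ -expectD; apply: ler_expect => // t.
have [all_right|/existsNP[j0 /negP j0_wrong]] := pselect (forall j, ~~ wrong j t).
  rewrite big1 ?mulr0 ?addr0 => [|j _]; last by rewrite (negbTE (all_right j)).
  suff -> : (fun j => decoded c i.1 (o j t)) = (fun=> c i) by [].
  apply/funext => j; have := all_right j; rewrite negbK => /eqP right.
  by rewrite /decoded right -surjective_pairing.
apply: le_trans (cost_le _ s t) _; rewrite ler_wpDl// ler_peMr//.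
by rewrite (bigD1 j0)//= (negPn j0_wrong) lerDl sumr_ge0.
Qed.

Lemma best_bin_cost_le (c : codebook) :
  expect (output PV A) (fun s => bin_cost c s (best_bin c s)) <=
  dmax * (\sum_s Num.max 0 (output PV A s - sample_mean (A^~ s) c))
  + #|{: 'I_M * 'I_K}|%:R^-1 * \sum_i expect (A (c i)) (fun s => bin_cost c s i.1).
Proof.
set L := #|_|%:R; have L_ge0 : 0 <= L^-1 :> R by rewrite invr_ge0.
rewrite exchange_big !mulr_sumr -big_split; apply: ler_sum => s _ /=.
set best := bin_cost c s _; set deficit := Num.max 0 _.
have mean_le : sample_mean (A^~ s) c * best <=
    L^-1 * \sum_i A (c i) s * bin_cost c s i.1.
  rewrite /sample_mean -mulrA ler_wpM2l// mulr_suml; apply: ler_sum => i _.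
  rewrite ler_wpM2l// /best /best_bin.
  by case: arg_minP => // m _ /(_ i.1 isT).
have deficit_ge0 : 0 <= deficit by rewrite le_max lexx.
have output_le : output PV A s <= deficit + sample_mean (A^~ s) c.
  by rewrite -lerBlDr le_max lexx orbT.
have := ler_wpM2r (bin_cost_ge0 c s (best_bin c s)) output_le.
have := ler_wpM2l deficit_ge0 (bin_cost_le c s (best_bin c s)).
by rewrite -/best; lra.
Qed.

Definition one_shot_error (tau : R) (tau_ : J -> R) : R :=
  density_gt PV A tau + Num.sqrt (tau / (M * K)%:R) +
  \sum_j (density_le PV (@observed j) (tau_ j) + K.-1%:R / tau_ j).

(* Random codebook of [M] bins of [K] codewords.  The cost of the best bin is at
   most the average cost over the posterior of the codeword index given [s], when
   [s] is the output of [A] on a uniformly chosen codeword; by soft covering, that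
   law of [s] is close to [output PV A]. *)
Lemma expect_best_bin_cost_le tau tau_ : 0 <= tau -> (forall j, 0 < tau_ j) ->
  expect (iid PV) (fun c =>
    expect (output PV A) (fun s => bin_cost c s (best_bin c s))) <=
  expect PV genie_cost + dmax * one_shot_error tau tau_.
Proof.
move=> tau0 tau_0; have codebook_pmf := iid_pmf ('I_M * 'I_K)%type PV_pmf.
have sizeE : #|{: 'I_M * 'I_K}| = (M * K)%N by rewrite card_prod !card_ord.
have size_gt0 : (0 < #|{: 'I_M * 'I_K}|)%N by rewrite sizeE muln_gt0 M_gt0.
apply: le_trans (ler_expect codebook_pmf.1 best_bin_cost_le) _.
rewrite expectD !expectZ expect_sum /one_shot_error.
have := soft_covering PV_pmf A_channel size_gt0 tau0.
move=> /(ler_wpM2l dmax_ge0) covering.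
rewrite [dmax * (_ + _)]mulrDr addrCA -sizeE; apply: lerD => //.
rewrite mulrC ler_pdivrMr ?ltr0n// mulr_natr -sumr_const.
apply: ler_sum => i _.
apply: le_trans (ler_expect codebook_pmf.1 (bin_cost_le_genie^~ i)) _.
rewrite expectD (expect_iid_coord PV_pmf) lerD2l expectZ ler_wpM2l//.
rewrite expect_sum; apply: ler_sum => j _; case: i => m k.
exact: (ml_index_error PV_pmf (observed_channel j)).
Qed.

Lemma one_shot tau tau_ : 0 <= tau -> (forall j, 0 < tau_ j) ->
  exists (f : S -> 'I_M) (g : forall j, 'I_M -> O j -> V),
  expect (output PV A)
    (fun s => expect (B s) (fun t => cost (fun j => g j (f s) (o j t)) s t)) <=
  expect PV genie_cost + dmax * one_shot_error tau tau_.
Proof.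
move=> tau0 tau_0; have [c good] := exists_le_expect
  (iid_pmf ('I_M * 'I_K)%type PV_pmf) (expect_best_bin_cost_le tau0 tau_0).
by exists (best_bin c), (fun j m x => @decoded c m j x).
Qed.

End OneShot.

(** * Coding with a state known to everybody *)

Section Tower.
Variables (R : realType) (T : finType) (P : T -> R).
Hypothesis P_pmf : is_pmf P.
Let P_ge0 := P_pmf.1.

Lemma expect_cond_indep (TA TB TC : finType)
    (A : T -> TA) (B : T -> TB) (C : T -> TC) (F : TA -> TC -> TB -> R) :
  cond_indep P A B C ->
  expect P (fun t => F (A t) (C t) (B t)) =
  expect P (fun t => expect (cond_law P B C (C t)) (F (A t) (C t))).
Proof.
move=> indep.
rewrite -(expect_law P [% A, B, C] (fun w => F w.1.1 w.2 w.1.2)).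
rewrite -(expect_law P [% A, C] (fun w => expect (cond_law P B C w.2) (F w.1 w.2))).
rewrite /expect sum_triple sum_pair /=; apply: eq_bigr => a _.
rewrite exchange_big; apply: eq_bigr => c _.
rewrite mulr_sumr; apply: eq_bigr => b _.
by rewrite (cond_indep_law P_pmf)// mulrA.
Qed.

Variables (TQ TV TS : finType) (Q : T -> TQ) (V : T -> TV) (S : T -> TS).
Variable A : TQ -> TV -> TS -> R.
Hypothesis lawA : forall q v s,
  law P [% V, Q] (v, q) * A q v s = law P [% V, S, Q] (v, s, q).
Local Notation PV := (cond_law P V Q).

Lemma expect_tower (F : TQ -> TV -> TS -> R) :
  expect (law P Q) (fun q => expect (PV q) (fun v => expect (A q v) (F q v))) =
  expect P (fun t => F (Q t) (V t) (S t)).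
Proof.
rewrite -(expect_law P [% V, S, Q] (fun w => F w.2 w.1.1 w.1.2)) /expect.
rewrite sum_pair exchange_big; apply: eq_bigr => q _; rewrite sum_pair /=.
rewrite mulr_sumr; apply: eq_bigr => v _ /=; rewrite !mulr_sumr.
by apply: eq_bigr => s _; rewrite -lawA -cond_lawE//; ring.
Qed.

Lemma prob_tower (E : TQ -> TV -> TS -> bool) :
  expect (law P Q) (fun q => expect (PV q) (fun v => prob (A q v) (E q v))) =
  prob P (fun t => E (Q t) (V t) (S t)).
Proof.
rewrite -expect_indic -(expect_tower (fun q v s => (E q v s)%:R)).
apply: eq_bigr => q _; congr (_ * _); apply: eq_bigr => v _; congr (_ * _).
by rewrite -expect_indic.
Qed.

Lemma law_output q s : law P Q q * output (PV q) (A q) s = law P [% S, Q] (s, q).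
Proof.
rewrite /output /expect mulr_sumr -(law_triple_suml P V S Q).
by apply: eq_bigr => v _; rewrite -lawA -cond_lawE//; ring.
Qed.

Lemma info_density_likelihood t : 0 < P t ->
  [/\ 0 < A (Q t) (V t) (S t), 0 < output (PV (Q t)) (A (Q t)) (S t)
    & info_density P V S Q t = ln (A (Q t) (V t) (S t)) -
        ln (output (PV (Q t)) (A (Q t)) (S t))].
Proof.
move=> Pt; have Q0 := law_gt0 P_ge0 Q Pt; have VQ0 := law_gt0 P_ge0 [% V, Q] Pt.
have := law_gt0 P_ge0 [% S, Q] Pt; have := law_gt0 P_ge0 [% V, S, Q] Pt.
rewrite /info_density -[law P [% S, Q] _]law_output -[law P [% V, S, Q] _]lawA.
rewrite !pmulr_rgt0// => A0 O0.
by rewrite ![ln (_ * _)]lnM ?posrE//; split=> //; ring.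
Qed.

Lemma expect_density_gt x :
  expect (law P Q) (fun q => density_gt (PV q) (A q) (expR x)) <=
  prob P (fun t => x < info_density P V S Q t).
Proof.
rewrite /density_gt (prob_tower (fun q v s =>
  expR x * output (PV q) (A q) s < A q v s)).
apply: le_prob => // t /info_density_likelihood[A0 O0 ->] gt.
by rewrite ltrBrDr -(expRK x) -lnM ?posrE ?expR_gt0// ltr_ln ?posrE ?mulr_gt0 ?expR_gt0.
Qed.

Lemma expect_density_le x :
  expect (law P Q) (fun q => density_le (PV q) (A q) (expR x)) <=
  prob P (fun t => info_density P V S Q t <= x).
Proof.
rewrite /density_le (prob_tower (fun q v s =>
  A q v s <= expR x * output (PV q) (A q) s)).
apply: le_prob => // t /info_density_likelihood[A0 O0 ->] gt.
by rewrite lerBlDr -(expRK x) -lnM ?posrE ?expR_gt0// ler_ln ?posrE ?mulr_gt0 ?expR_gt0.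
Qed.

End Tower.

Section StateCoding.
Variables (R : realType) (T : finType) (P : T -> R).
Variables (TQ TV TS TD : finType).
Variables (Q : T -> TQ) (V : T -> TV) (S : T -> TS) (D : T -> TD).
Variables (J : finType) (O : J -> finType) (o : forall j, TD -> O j).
Hypotheses (P_pmf : is_pmf P) (markov : cond_indep P V D [% S, Q]).
Let P_ge0 := P_pmf.1.

Local Notation PV := (cond_law P V Q).
Let A q v := cond_law P S [% V, Q] (v, q).
Let B q s := cond_law P D [% S, Q] (s, q).
Let A_channel q : is_channel (A q).
Proof. by move=> v; apply: cond_law_channel. Qed.
Let B_channel q : is_channel (B q).
Proof. by move=> s; apply: cond_law_channel. Qed.

Let lawA q v s : law P [% V, Q] (v, q) * A q v s = law P [% V, S, Q] (v, s, q).
Proof.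
by rewrite cond_lawE//; apply: eq_law; rv_congr.
Qed.

Let law_observed j q v x :
  law P [% V, Q] (v, q) * observed (A q) (B q) o (j := j) v x =
  law P [% V, o j \o D, Q] (v, x, q).
Proof.
transitivity (\sum_s law P [% V, o j \o D, [% S, Q]] (v, x, (s, q))).
  rewrite mulr_sumr; apply: eq_bigr => s _; rewrite law_triple_compm mulrA lawA.
  rewrite [law (B q s) _ _]/law mulr_sumr; apply: eq_bigr => d _.
  rewrite (cond_indep_law P_pmf _ _ _ markov); congr (_ * _).
  by apply: eq_law; rv_congr.
rewrite -(law_pair_suml P S); apply: eq_bigr => s _.
by apply: eq_law; rv_congr.
Qed.

Variables (M K : nat) (cost : TQ -> (J -> TV) -> TS -> TD -> R) (dmax : R).
Hypotheses (M_gt0 : (0 < M)%N) (K_gt0 : (0 < K)%N) (dmax_ge0 : 0 <= dmax).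
Hypothesis cost_ge0 : forall q vs s d, 0 <= cost q vs s d.
Hypothesis cost_le : forall q vs s d, cost q vs s d <= dmax.

Lemma one_shot_state x (y : J -> R) :
  exists (f : TQ -> TS -> 'I_M) (g : forall j, TQ -> 'I_M -> O j -> TV),
  expect P (fun t => cost (Q t)
    (fun j => g j (Q t) (f (Q t) (S t)) (o j (D t))) (S t) (D t)) <=
  expect P (fun t => cost (Q t) (fun=> V t) (S t) (D t)) +
  dmax * (prob P (fun t => x < info_density P V S Q t)
          + Num.sqrt (expR x / (M * K)%:R)
          + \sum_j (prob P (fun t => info_density P V (o j \o D) Q t <= y j)
                    + K.-1%:R / expR (y j))).
Proof.
have code q : exists fg : (TS -> 'I_M) * (forall j, 'I_M -> O j -> TV),
    expect (output (PV q) (A q)) (fun s => expect (B q s) (fun d =>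
      cost q (fun j => fg.2 j (fg.1 s) (o j d)) s d)) <=
    expect (PV q) (genie_cost (A q) (B q) (cost q)) +
    dmax * one_shot_error M K (PV q) (A q) (B q) o (expR x) (fun j => expR (y j)).
  have [f [g fg_cost]] := one_shot o (cond_law_channel P_pmf V Q q) (A_channel q)
    (B_channel q) dmax_ge0 (cost_ge0 q) (cost_le q) M_gt0 K_gt0 (expR_ge0 x)
    (fun j => expR_gt0 (y j)).
  by exists (f, g).
have {code}[fg fg_cost] := choice code.
exists (fun q => (fg q).1), (fun j q => (fg q).2 j).
have lawQ := law_pmf Q P_pmf.
have markov_cst : cond_indep P (fun=> tt) D [% S, Q].
  by apply: (cond_indepW P_ge0 markov); rv_congr.
rewrite (expect_cond_indep P_pmf (fun _ sq d => cost sq.2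
  (fun j => (fg sq.2).2 j ((fg sq.2).1 sq.1) (o j d)) sq.1 d) markov_cst).
rewrite (expect_cond_indep P_pmf (fun v sq d => cost sq.2 (fun=> v) sq.1 d) markov).
rewrite -(expect_tower P_pmf lawA (fun q v s => expect (B q s) (fun d =>
  cost q (fun j => (fg q).2 j ((fg q).1 s) (o j d)) s d))).
rewrite -(expect_tower P_pmf lawA (fun q v s => expect (B q s) (cost q (fun=> v) s))).
under [leLHS]eq_bigr do rewrite -expect_output.
apply: le_trans (ler_expect lawQ.1 fg_cost) _.
rewrite expectD expectZ lerD2l ler_wpM2l// !expectD expect_cst// expect_sum.
apply: lerD; first by rewrite lerD2r expect_density_gt.
apply: ler_sum => j _; rewrite expectD expect_cst// lerD2r.
exact: (expect_density_le P_pmf (@law_observed j)).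
Qed.

End StateCoding.

(** * Block coding *)

Section BlockCoding.
Variable R : realType.

Lemma expRN_near0 (c eps : R) : 0 < c -> 0 < eps ->
  \forall n \near \oo, expR (- (n%:R * c)) <= eps.
Proof.
move=> c0 eps0; near=> n.
have large : eps^-1 <= n%:R * c.
  by rewrite -ler_pdivrMr//; near: n; apply: nbhs_infty_ger.
rewrite expRN -[eps]invrK lef_pV2 ?posrE ?invr_gt0 ?expR_gt0//.
by apply: le_trans large _; have := expR_ge1Dx (n%:R * c); lra.
Unshelve. all: by end_near. Qed.

Lemma expR_le_truncn_near (a b : R) : 0 <= a < b ->
  \forall n \near \oo, expR (n%:R * a) <= (Num.truncn (expR (n%:R * b)))%:R.
Proof.
move=> /andP[a0 ab]; near=> n.
have half : expR (- (n%:R * (b - a))) <= 2^-1.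
  by near: n; apply: expRN_near0; rewrite ?subr_gt0 ?invr_gt0.
have a1 : 1 <= expR (n%:R * a) by rewrite -[leLHS]expR0 ler_expR mulr_ge0.
have aE : expR (n%:R * a) = expR (n%:R * b) * expR (- (n%:R * (b - a))).
  by rewrite -expRD; congr expR; ring.
have := ler_wpM2l (expR_ge0 (n%:R * b)) half; rewrite -aE.
have /andP[_] := truncn_itv (expR_ge0 (n%:R * b)); rewrite -natr1; lra.
Unshelve. all: by end_near. Qed.

Lemma covering_term_near (a b x eps : R) : x < a + b -> 0 < eps ->
  \forall n \near \oo, forall M K : nat,
    expR (n%:R * a) <= M%:R -> expR (n%:R * b) <= K%:R ->
    Num.sqrt (expR (n%:R * x) / (M * K)%:R) <= eps.
Proof.
rewrite -subr_gt0 => gap eps0; near=> n => M K leM leK.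
have MK : expR (n%:R * (a + b)) <= (M * K)%:R.
  by rewrite natrM mulrDr expRD ler_pM ?expR_ge0.
have -> : eps = Num.sqrt (eps ^+ 2) by rewrite sqrtr_sqr ger0_norm// ltW.
rewrite ler_sqrt ?sqr_ge0//.
apply: (@le_trans _ _ (expR (- (n%:R * (a + b - x))))); last first.
  by near: n; apply: expRN_near0; rewrite ?exprn_gt0.
rewrite ler_pdivrMr ?(lt_le_trans _ MK) ?expR_gt0//.
apply: le_trans (ler_wpM2l (expR_ge0 _) MK).
by rewrite -expRD ler_expR; lra.
Unshelve. all: by end_near. Qed.

Lemma packing_term_near (b y eps : R) : b < y -> 0 < eps ->
  \forall n \near \oo,
    (Num.truncn (expR (n%:R * b)))%:R / expR (n%:R * y) <= eps.
Proof.
rewrite -subr_gt0 => gap eps0; apply: filterS (expRN_near0 gap eps0) => n.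
have /andP[trunc_le _] := truncn_itv (expR_ge0 (n%:R * b)).
apply: le_trans; rewrite ler_pdivrMr ?expR_gt0//; apply: le_trans trunc_le _.
by rewrite -expRD ler_expR; lra.
Qed.

Section Tails.
Variables (T TA TB TC : finType) (P : T -> R).
Variables (A : T -> TA) (B : T -> TB) (C : T -> TC).
Hypothesis P_pmf : is_pmf P.

Lemma info_density_upper_tail c eps : cond_info P A B C < c -> 0 < eps ->
  \forall n \near \oo, prob (iid P) (fun w : {ffun 'I_n -> T} =>
    n%:R * c < info_density (iid P) (rv_seq A) (rv_seq B) (rv_seq C) w) <= eps.
Proof.
move=> info_lt eps0.
have mean : - c < expect P (fun t => - info_density P A B C t).
  by rewrite expectN ltrN2.
apply: filterS (weak_law_lower_tail P_pmf mean eps0) => n; apply: le_trans.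
apply: le_prob => [w|w w0]; first exact: (iid_pmf _ P_pmf).1.
by rewrite (info_density_rv_seq A B C P_pmf.1 w0) sumrN mulrN lerN2; apply: ltW.
Qed.

Lemma info_density_lower_tail c eps : c < cond_info P A B C -> 0 < eps ->
  \forall n \near \oo, prob (iid P) (fun w : {ffun 'I_n -> T} =>
    info_density (iid P) (rv_seq A) (rv_seq B) (rv_seq C) w <= n%:R * c) <= eps.
Proof.
move=> info_gt eps0; apply: filterS (weak_law_lower_tail P_pmf info_gt eps0) => n.
apply: le_trans; apply: le_prob => [w|w w0]; first exact: (iid_pmf _ P_pmf).1.
by rewrite (info_density_rv_seq A B C P_pmf.1 w0).
Qed.

End Tails.

Variables (T TQ TV TS TD : finType) (P : T -> R).
Variables (Q : T -> TQ) (V : T -> TV) (S : T -> TS) (D : T -> TD).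
Variables (J : finType) (O : J -> finType) (o : forall j, TD -> O j).
Hypotheses (P_pmf : is_pmf P) (markov : cond_indep P V D [% S, Q]).

Lemma coding_error_near a b eps :
  cond_info P V S Q < a + b -> (forall j, b < cond_info P V (o j \o D) Q) ->
  0 < eps ->
  exists x (y : J -> R), \forall n \near \oo, forall M K : nat,
    expR (n%:R * a) <= M%:R -> K = (Num.truncn (expR (n%:R * b))).+1 ->
  prob (iid P) (fun w : {ffun 'I_n -> T} =>
    n%:R * x < info_density (iid P) (rv_seq V) (rv_seq S) (rv_seq Q) w)
  + Num.sqrt (expR (n%:R * x) / (M * K)%:R)
  + \sum_j (prob (iid P) (fun w : {ffun 'I_n -> T} =>
      info_density (iid P) (rv_seq V) (rv_seq (o j \o D)) (rv_seq Q) w <= n%:R * y j)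
    + K.-1%:R / expR (n%:R * y j)) <= eps.
Proof.
move=> cover resolve eps0.
pose x := (cond_info P V S Q + (a + b)) / 2.
pose y j := (b + cond_info P V (o j \o D) Q) / 2; exists x, y.
have [info_lt_x x_lt] : cond_info P V S Q < x /\ x < a + b by rewrite /x; lra.
have b_lt_y j : b < y j by have := resolve j; rewrite /y; lra.
have y_lt_info j : y j < cond_info P V (o j \o D) Q.
  by have := resolve j; rewrite /y; lra.
pose eta := eps / (2 * (1 + #|J|%:R)).
have J1 : 0 < 1 + #|J|%:R :> R by rewrite ltr_pwDl.
have eta0 : 0 < eta by rewrite divr_gt0// mulr_gt0.
have epsE : eps = eta + eta + \sum_(j : J) (eta + eta).
  by rewrite sumr_const -mulr_natl /eta; field; rewrite gt_eqF.
have receivers : \forall n \near \oo, forall j,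
    prob (iid P) (fun w : {ffun 'I_n -> T} =>
      info_density (iid P) (rv_seq V) (rv_seq (o j \o D)) (rv_seq Q) w
        <= n%:R * y j) <= eta /\
    (Num.truncn (expR (n%:R * b)))%:R / expR (n%:R * y j) <= eta.
  apply: filter_forall => j.
  exact: filterS2 (fun _ => @conj _ _) (info_density_lower_tail _ (y_lt_info j) eta0)
    (packing_term_near (b_lt_y j) eta0).
apply: filterS3 receivers (info_density_upper_tail P_pmf info_lt_x eta0)
  (covering_term_near x_lt eta0) => n receiver upper_tail covering M K M_ge ->.
rewrite epsE; apply: lerD; first apply: lerD => //.
  by apply: covering => //; have /andP[_ /ltW] := truncn_itv (expR_ge0 (n%:R * b)).
by apply: ler_sum => j _; have [lower_tail packing] := receiver j; apply: lerD.
Qed.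

(* [M] bins of about [expR (n * b)] codewords: together they cover [S], and each
   receiver resolves a bin. *)
Lemma block_coding a b eps :
  cond_info P V S Q < a + b -> (forall j, b < cond_info P V (o j \o D) Q) ->
  0 < eps ->
  \forall n \near \oo, forall M dmax (cost : {ffun 'I_n -> TQ} ->
      (J -> {ffun 'I_n -> TV}) -> {ffun 'I_n -> TS} -> {ffun 'I_n -> TD} -> R),
    expR (n%:R * a) <= M%:R -> 0 <= dmax ->
    (forall q vs s d, 0 <= cost q vs s d) ->
    (forall q vs s d, cost q vs s d <= dmax) ->
  exists (f : {ffun 'I_n -> TQ} -> {ffun 'I_n -> TS} -> 'I_M)
    (g : forall j, {ffun 'I_n -> TQ} -> 'I_M -> {ffun 'I_n -> O j} ->
           {ffun 'I_n -> TV}),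
  expect (iid P) (fun w => cost (rv_seq Q w)
    (fun j => g j (rv_seq Q w) (f (rv_seq Q w) (rv_seq S w))
                (rv_seq (o j) (rv_seq D w)))
    (rv_seq S w) (rv_seq D w)) <=
  expect (iid P) (fun w =>
    cost (rv_seq Q w) (fun=> rv_seq V w) (rv_seq S w) (rv_seq D w)) + dmax * eps.
Proof.
move=> cover resolve eps0; have [x [y small]] := coding_error_near cover resolve eps0.
apply: filterS small => n small M dmax cost rate dmax0 cost_ge0 cost_le.
have M_gt0 : (0 < M)%N by rewrite -(ltr0n R) (lt_le_trans _ rate)// expR_gt0.
have markov_n := cond_indep_rv_seq_pair (I := 'I_n) P_pmf.1 markov.
have [f [g le_fg]] := one_shot_state (fun j => rv_seq (o j)) (iid_pmf 'I_n P_pmf)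
  markov_n M_gt0 (ltn0Sn (Num.truncn (expR (n%:R * b)))) dmax0 cost_ge0 cost_le
  (n%:R * x) (fun j => n%:R * y j).
exists f, g; apply: le_trans le_fg _; rewrite lerD2l ler_wpM2l//.
under eq_bigr do rewrite rv_seq_comp.
exact: small.
Qed.

End BlockCoding.

(** * Single-letter laws *)

Section Joint.
Variables (X Y Z U V : Type).

Definition rvX (t : X * Y * Z * U * V) : X := t.1.1.1.1.
Definition rvY (t : X * Y * Z * U * V) : Y := t.1.1.1.2.
Definition rvZ (t : X * Y * Z * U * V) : Z := t.1.1.2.
Definition rvU (t : X * Y * Z * U * V) : U := t.1.2.
Definition rvV (t : X * Y * Z * U * V) : V := t.2.

End Joint.

Arguments rvX {X Y Z U V} t.
Arguments rvY {X Y Z U V} t.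
Arguments rvZ {X Y Z U V} t.
Arguments rvU {X Y Z U V} t.
Arguments rvV {X Y Z U V} t.

Section SingleLetter.
Variables (R : realType) (X Y Z Xh : finType).
Variables (pZY : Z * Y -> R) (W : Z -> X -> R) (d : X -> Xh -> R).
Local Notation p := (pXYZ pZY W).

Definition source (t : X * Y * Z) : R := p t.1.1 t.1.2 t.2.

Definition joint (U V : Type) (q : Y -> U -> R) (r : X * U -> V -> R)
    (t : X * Y * Z * U * V) : R :=
  let: (x, y, z, u, v) := t in p x y z * q y u * r (x, u) v.

Hypotheses (pZY_pmf : is_pmf pZY) (W_channel : is_channel W).

Lemma source_pmf : is_pmf source.
Proof.
split=> [t|]; first by rewrite mulr_ge0 ?pZY_pmf.1 ?(W_channel _).1.
rewrite sum_triple exchange_big /=.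
have -> : \sum_y \sum_x \sum_z source (x, y, z) = \sum_y \sum_z pZY (z, y).
  apply: eq_bigr => y _; rewrite exchange_big; apply: eq_bigr => z _ /=.
  by rewrite -[RHS]mulr1 -(W_channel z).2 mulr_sumr.
by rewrite exchange_big -sum_pair pZY_pmf.2.
Qed.

Lemma joint_ge0 (U V : Type) (q : Y -> U -> R) (r : X * U -> V -> R) t :
  (forall y u, 0 <= q y u) -> (forall xu v, 0 <= r xu v) -> 0 <= joint q r t.
Proof.
move: t => [[[[x y] z] u] v] q0 r0; have p0 := source_pmf.1 (x, y, z).
by apply: mulr_ge0 => //; apply: mulr_ge0.
Qed.

Section Channels.
Variables (U V : finType) (q : Y -> U -> R) (r : X * U -> V -> R).
Hypotheses (q_channel : is_channel q) (r_channel : is_channel r).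
Local Notation P := (joint q r).
Local Notation T := (X * Y * Z * U * V)%type.

Lemma law_joint_UXZY u x z y :
  law P [% rvU, [% rvX, rvZ], rvY] (u, (x, z), y) = q y u * p x y z.
Proof.
rewrite (law_fiber _ (B := rvV) (e := fun v => (x, y, z, u, v)))//; last first.
  by move=> [[[[x' y'] z'] u'] v'] [/= <- <- <- <-].
by rewrite -mulr_sumr (r_channel (x, u)).2 mulr1 mulrC.
Qed.

Lemma law_joint_XYZ : law P [% rvX, rvY, rvZ] =1 source.
Proof.
move=> [[x y] z]; rewrite -(law_pair_suml P rvU).
rewrite (eq_bigr (fun u => q y u * p x y z)) => [|u _].
  by rewrite -mulr_suml (q_channel y).2 mul1r.
by rewrite -law_joint_UXZY; apply: eq_law; rv_congr.
Qed.

Lemma joint_pmf : is_pmf P.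
Proof.
split=> [t|].
  by apply: joint_ge0 => [y|xu]; [exact: (q_channel y).1 | exact: (r_channel xu).1].
rewrite -(sum_law P [% rvX, rvY, rvZ]) -source_pmf.2.
by apply: eq_bigr => t _; apply: law_joint_XYZ.
Qed.

Lemma law_joint_VYZXU v y z x u :
  law P [% rvV, [% rvY, rvZ], [% rvX, rvU]] (v, (y, z), (x, u)) =
  r (x, u) v * (p x y z * q y u).
Proof.
rewrite mulrC /law (big_pred1 (x, y, z, u, v))// => -[[[[x' y'] z'] u'] v'].
by apply/eqP/eqP => -[/= <- <- <- <- <-].
Qed.

Lemma joint_U_XZ_given_Y : cond_indep P rvU [% rvX, rvZ] rvY.
Proof.
apply: (cond_indep_factor (F := fun u y => q y u)
  (G := fun xz y => p xz.1 y xz.2)) => u [x z] y.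
exact: law_joint_UXZY.
Qed.

(* The Markov chain [Y - Z - X] of the source enters here. *)
Lemma joint_U_X_given_Z : cond_indep P rvU rvX rvZ.
Proof.
apply: (cond_indep_factor (F := fun u z => \sum_y q y u * pZY (z, y))
  (G := fun x z => W z x)) => u x z.
rewrite -(law_pair_suml P rvY) mulr_suml; apply: eq_bigr => y _.
rewrite -mulrA -[_ * W z x]/(p x y z) -law_joint_UXZY.
by apply: eq_law; rv_congr.
Qed.

Lemma joint_V_YZ_given_XU : cond_indep P rvV [% rvY, rvZ] [% rvX, rvU].
Proof.
apply: (cond_indep_factor (F := fun v xu => r xu v)
  (G := fun yz xu => p xu.1 yz.1 yz.2 * q yz.1 xu.2)) => v [y z] [x u].
exact: law_joint_VYZXU.
Qed.

End Channels.

Section BlockDistortion.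
Variable n : nat.

Definition mean_distortion (xs : {ffun 'I_n -> X}) (xhs : {ffun 'I_n -> Xh}) : R :=
  n%:R^-1 * \sum_(i < n) d (xs i) (xhs i).

Lemma code_distortionE M1 M (f1 : {ffun 'I_n -> Y} -> 'I_M1)
    (f : {ffun 'I_n -> X} -> 'I_M1 -> 'I_M)
    (g : 'I_M -> 'I_M1 -> {ffun 'I_n -> Z} -> {ffun 'I_n -> Xh})
    (T : finType) (P : T -> R) (A : T -> X) (B : T -> Y) (C : T -> Z) :
  law P [% A, B, C] =1 source ->
  code_distortion pZY W d f1 f g =
  expect (iid P) (fun w => let m1 := f1 (rv_seq B w) in
    mean_distortion (rv_seq A w) (g (f (rv_seq A w) m1) m1 (rv_seq C w))).
Proof.
move=> lawABC; pose cost xs ys zs :=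
  mean_distortion xs (g (f xs (f1 ys)) (f1 ys) zs).
transitivity (expect (law (iid P) [% rv_seq A, rv_seq B, rv_seq C])
    (fun w => cost w.1.1 w.1.2 w.2)); last by rewrite expect_law.
rewrite /expect sum_triple.
apply: eq_bigr => xs _; apply: eq_bigr => ys _; apply: eq_bigr => zs _.
rewrite law_rv_family3; congr (_ * _).
by apply: eq_bigr => i _; rewrite lawABC.
Qed.

Definition total_distortion : R := \sum_x \sum_xh d x xh.

Hypothesis d_ge0 : forall x xh, 0 <= d x xh.

Lemma total_distortion_ge0 : 0 <= total_distortion.
Proof. by apply: sumr_ge0 => x _; apply: sumr_ge0. Qed.

Lemma mean_distortion_ge0 xs xhs : 0 <= mean_distortion xs xhs.
Proof. by rewrite mulr_ge0 ?invr_ge0// sumr_ge0. Qed.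

Lemma mean_distortion_le xs xhs : mean_distortion xs xhs <= total_distortion.
Proof.
have d_le x xh : d x xh <= total_distortion.
  rewrite /total_distortion (bigD1 x)//= (bigD1 xh)//= -addrA lerDl.
  by rewrite addr_ge0 ?sumr_ge0// => x' _; apply: sumr_ge0.
rewrite /mean_distortion mulrC.
have [n0|n_gt0] := posnP n; last first.
  rewrite ler_pdivrMr ?ltr0n//.
  apply: le_trans (ler_sum _ (fun i _ => d_le (xs i) (xhs i))) _.
  by rewrite sumr_const card_ord mulr_natr.
have -> : n%:R^-1 = 0 :> R by rewrite n0 invr0.
by rewrite mulr0 total_distortion_ge0.
Qed.

End BlockDistortion.
End SingleLetter.

(** * Achievability *)

Section Achievability.
Variables (R : realType) (X Y Z Xh U V : finType).
Variables (pZY : Z * Y -> R) (W : Z -> X -> R) (d : X -> Xh -> R).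
Hypotheses (pZY_pmf : is_pmf pZY) (W_channel : is_channel W).
Hypothesis d_ge0 : forall x xh, 0 <= d x xh.
Variables (q : Y -> U -> R) (r : X * U -> V -> R) (xhat : U -> V -> Z -> Xh).
Hypotheses (q_channel : is_channel q) (r_channel : is_channel r).
Local Notation P := (joint pZY W q r).
Let P_pmf : is_pmf P := joint_pmf pZY_pmf W_channel q_channel r_channel.
Let P_ge0 := P_pmf.1.
Local Notation cst := (fun=> tt).
Local Notation dmax := (total_distortion d).
Let dmax_ge0 : 0 <= dmax := total_distortion_ge0 d_ge0.

(* The gap [I(U;Y) - I(U;X)] is [I(U;Y|X)], and [I(U;X) <= I(U;Z)]: whatever bin
   of the helper's codebook the encoder resolves, so does the decoder. *)
Lemma helper_rates a : cond_info P rvU rvY rvX < a ->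
  exists2 b, cond_info P rvU rvY cst < a + b &
    b < cond_info P rvU rvX cst /\ b < cond_info P rvU rvZ cst.
Proof.
have UX_Y : cond_indep P rvU rvX [% rvY, cst].
  by apply: (cond_indepW P_ge0 (joint_U_XZ_given_Y pZY W q r_channel)); rv_congr.
have UX_Z : cond_indep P rvU rvX [% rvZ, cst].
  by apply: (cond_indepW P_ge0 (joint_U_X_given_Z pZY W q r_channel)); rv_congr.
have -> : cond_info P rvU rvY rvX = cond_info P rvU rvY [% rvX, cst].
  by apply: eq_cond_info; rv_congr.
rewrite (cond_info_chain P_ge0 UX_Y); have := data_processing P_ge0 UX_Z.
set IX := cond_info P rvU rvX cst; set IY := cond_info P rvU rvY cst.
by move=> IXZ gap; exists ((IX + (IY - a)) / 2); lra.
Qed.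

Lemma encoder_rates a : cond_info P rvX rvV [% rvU, rvZ] < a ->
  exists2 b, cond_info P rvV rvX rvU < a + b & b < cond_info P rvV rvZ rvU.
Proof.
have VZ_XU : cond_indep P rvV rvZ [% rvX, rvU].
  by apply: (cond_indepW P_ge0 (joint_V_YZ_given_XU pZY W q r)); rv_congr.
have -> : cond_info P rvX rvV [% rvU, rvZ] = cond_info P rvV rvX [% rvZ, rvU].
  by rewrite cond_infoC; apply: eq_cond_info; rv_congr.
rewrite (cond_info_chain P_ge0 VZ_XU).
set IX := cond_info P rvV rvX rvU; set IZ := cond_info P rvV rvZ rvU.
by move=> gap; exists ((IZ + (IX - a)) / 2); lra.
Qed.

Definition reconstruct n (us : {ffun 'I_n -> U}) (vs : {ffun 'I_n -> V})
    (zs : {ffun 'I_n -> Z}) : {ffun 'I_n -> Xh} :=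
  [ffun i => xhat (us i) (vs i) (zs i)].

Lemma expect_reconstruct n : (0 < n)%N ->
  expect (iid P) (fun w : {ffun 'I_n -> X * Y * Z * U * V} =>
    mean_distortion d (rv_seq rvX w)
      (reconstruct (rv_seq rvU w) (rv_seq rvV w) (rv_seq rvZ w))) =
  expect P (fun t => d (rvX t) (xhat (rvU t) (rvV t) (rvZ t))).
Proof.
move=> n_gt0; set single := fun t => d (rvX t) (xhat (rvU t) (rvV t) (rvZ t)).
transitivity (n%:R^-1 * \sum_(i < n)
    expect (iid P) (fun w : {ffun 'I_n -> X * Y * Z * U * V} => single (w i))).
  rewrite -expect_sum -expectZ; apply: eq_bigr => w _; congr (_ * (_ * _)).
  by apply: eq_bigr => i _; rewrite !ffunE.
under eq_bigr do rewrite expect_iid_coord//.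
by rewrite sumr_const card_ord -[expect _ _ *+ n]mulr_natl mulKf// pnatr_eq0 -lt0n.
Qed.

Lemma encoder_block_coding a eps :
  cond_info P rvX rvV [% rvU, rvZ] < a -> 0 < eps ->
  \forall n \near \oo, forall M, expR (n%:R * a) <= M%:R ->
  exists (f : {ffun 'I_n -> U} -> {ffun 'I_n -> X} -> 'I_M)
    (g : {ffun 'I_n -> U} -> 'I_M -> {ffun 'I_n -> Z} -> {ffun 'I_n -> V}),
  expect (iid P) (fun w => let us := rv_seq rvU w in let zs := rv_seq rvZ w in
    mean_distortion d (rv_seq rvX w)
      (reconstruct us (g us (f us (rv_seq rvX w)) zs) zs)) <=
  expect P (fun t => d (rvX t) (xhat (rvU t) (rvV t) (rvZ t))) + dmax * eps.
Proof.
move=> /encoder_rates[b cover resolve] eps0.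
have VZ_XU : cond_indep P rvV rvZ [% rvX, rvU].
  by apply: (cond_indepW P_ge0 (joint_V_YZ_given_XU pZY W q r)); rv_congr.
have coding := block_coding (o := fun _ : unit => id) P_pmf VZ_XU cover
  (fun=> resolve) eps0.
apply: filterS2 coding (nbhs_infty_gt 0) => n coding n_gt0 M rate.
have [||f [g fg]] := coding M dmax (fun us vs xs zs =>
  mean_distortion d xs (reconstruct us (vs tt) zs)) rate dmax_ge0.
- by move=> *; apply: mean_distortion_ge0.
- by move=> *; apply: mean_distortion_le.
exists f, (fun us m zs => g tt us m (rv_seq id zs)).
by rewrite -(expect_reconstruct n_gt0).
Qed.

Lemma helper_block_coding a eps :
  cond_info P rvU rvY rvX < a -> 0 < eps ->
  \forall n \near \oo, forall M (cost : {ffun 'I_n -> U} -> {ffun 'I_n -> U} ->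
      {ffun 'I_n -> X} -> {ffun 'I_n -> Z} -> R),
    expR (n%:R * a) <= M%:R ->
    (forall us us' xs zs, 0 <= cost us us' xs zs) ->
    (forall us us' xs zs, cost us us' xs zs <= dmax) ->
  exists (f : {ffun 'I_n -> Y} -> 'I_M)
    (g : 'I_M -> {ffun 'I_n -> X} -> {ffun 'I_n -> U})
    (g' : 'I_M -> {ffun 'I_n -> Z} -> {ffun 'I_n -> U}),
  expect (iid P) (fun w => let m := f (rv_seq rvY w) in
    cost (g m (rv_seq rvX w)) (g' m (rv_seq rvZ w)) (rv_seq rvX w) (rv_seq rvZ w)) <=
  expect (iid P) (fun w =>
    cost (rv_seq rvU w) (rv_seq rvU w) (rv_seq rvX w) (rv_seq rvZ w)) + dmax * eps.
Proof.
move=> /helper_rates[b cover [resolveX resolveZ]] eps0.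
have UXZ_Y : cond_indep P rvU [% rvX, rvZ] [% rvY, cst].
  by apply: (cond_indepW P_ge0 (joint_U_XZ_given_Y pZY W q r_channel)); rv_congr.
pose o (encoder : bool) :=
  if encoder return X * Z -> (if encoder then X else Z : finType) then fst else snd.
have resolve (encoder : bool) : b < cond_info P rvU (o encoder \o [% rvX, rvZ]) cst.
  by case: encoder.
have coding := block_coding P_pmf UXZ_Y cover resolve eps0.
apply: filterS coding => n coding M cost rate cost_ge0 cost_le.
have [//|//|f [g fg]] := coding M dmax (fun _ us _ xzs =>
  cost (us true) (us false) (rv_seq fst xzs) (rv_seq snd xzs)) rate dmax_ge0.
pose no_state : {ffun 'I_n -> unit} := [ffun=> tt].
exists (f no_state), (g true no_state), (g false no_state).
have no_stateE (w : {ffun 'I_n -> X * Y * Z * U * V}) : rv_seq cst w = no_state.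
  by apply/ffunP => i; rewrite !ffunE.
have fstE (w : {ffun 'I_n -> X * Y * Z * U * V}) :
    rv_seq fst (rv_seq [% rvX, rvZ] w) = rv_seq rvX w.
  by apply/ffunP => i; rewrite !ffunE.
have sndE (w : {ffun 'I_n -> X * Y * Z * U * V}) :
    rv_seq snd (rv_seq [% rvX, rvZ] w) = rv_seq rvZ w.
  by apply/ffunP => i; rewrite !ffunE.
move: fg; rewrite /expect /o; under eq_bigr => w _ do rewrite fstE sndE no_stateE.
by under [X in _ <= X + _]eq_bigr => w _ do rewrite fstE sndE.
Qed.

Lemma truncn_rate a R0 : 0 <= a < R0 * ln 2 -> \forall n \near \oo,
  exists2 M : nat, expR (n%:R * a) <= M%:R & M%:R <= powR 2 (n%:R * R0) :> R.
Proof.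
move=> /expR_le_truncn_near; apply: filterS => n rate.
exists (Num.truncn (expR (n%:R * (R0 * ln 2)))) => //.
rewrite /powR pnatr_eq0 /= -mulrA.
by case/andP: (truncn_itv (expR_ge0 (n%:R * (R0 * ln 2)))).
Qed.

Lemma two_stage_coding a1 a2 eps :
  cond_info P rvU rvY rvX < a1 -> cond_info P rvX rvV [% rvU, rvZ] < a2 ->
  0 < eps ->
  \forall n \near \oo, forall M1 M,
    expR (n%:R * a1) <= M1%:R -> expR (n%:R * a2) <= M%:R ->
  exists (f1 : {ffun 'I_n -> Y} -> 'I_M1) (f : {ffun 'I_n -> X} -> 'I_M1 -> 'I_M)
    (g : 'I_M -> 'I_M1 -> {ffun 'I_n -> Z} -> {ffun 'I_n -> Xh}),
  code_distortion pZY W d f1 f g <=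
  expect P (fun t => d (rvX t) (xhat (rvU t) (rvV t) (rvZ t)))
    + dmax * eps + dmax * eps.
Proof.
move=> helper_lt encoder_lt eps0.
apply: filterS2 (helper_block_coding helper_lt eps0)
  (encoder_block_coding encoder_lt eps0) => n helper encoder M1 M rate1 rate.
have [f [g le_fg]] := encoder M rate.
have [||f1 [h [h' le_h]]] := helper M1 (fun us us' xs zs =>
  mean_distortion d xs (reconstruct us' (g us' (f us xs) zs) zs)) rate1.
- by move=> *; apply: mean_distortion_ge0.
- by move=> *; apply: mean_distortion_le.
exists f1, (fun xs m => f (h m xs) xs),
  (fun t m zs => reconstruct (h' m zs) (g (h' m zs) t zs) zs).
rewrite (code_distortionE d _ _ _ (law_joint_XYZ pZY W q_channel r_channel)).
by apply: le_trans le_h _; rewrite lerD2r.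
Qed.

Lemma sl_achievable D Rt R1 :
  expect P (fun t => d (rvX t) (xhat (rvU t) (rvV t) (rvZ t))) <= D ->
  cond_info P rvU rvY rvX < R1 * ln 2 ->
  cond_info P rvX rvV [% rvU, rvZ] < Rt * ln 2 ->
  achievable pZY W d D Rt R1.
Proof.
move=> le_D helper_lt encoder_lt eps eps0.
have [a1 helper_a1 a1_R1] : exists2 a, cond_info P rvU rvY rvX < a & a < R1 * ln 2.
  by exists ((cond_info P rvU rvY rvX + R1 * ln 2) / 2); lra.
have [a encoder_a a_Rt] : exists2 a,
    cond_info P rvX rvV [% rvU, rvZ] < a & a < Rt * ln 2.
  by exists ((cond_info P rvX rvV [% rvU, rvZ] + Rt * ln 2) / 2); lra.
have a1_ge0 : 0 <= a1 by apply/ltW/le_lt_trans/helper_a1/cond_info_ge0.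
have a_ge0 : 0 <= a by apply/ltW/le_lt_trans/encoder_a/cond_info_ge0.
pose eta := eps / (2 * (1 + dmax)).
have eta0 : 0 < eta by rewrite divr_gt0// mulr_gt0// ltr_wpDr.
have eta_le : dmax * eta + dmax * eta <= eps.
  have : eta * (2 * (1 + dmax)) = eps by rewrite divfK// gt_eqF// mulr_gt0// ltr_wpDr.
  by lra.
have rate1 : 0 <= a1 < R1 * ln 2 by rewrite a1_ge0.
have rate : 0 <= a < Rt * ln 2 by rewrite a_ge0.
suff [N _ codes] : \forall n \near \oo, exists M1 M : nat,
    M1%:R <= powR 2 (n%:R * R1) /\ M%:R <= powR 2 (n%:R * Rt) /\
    exists (f1 : {ffun 'I_n -> Y} -> 'I_M1) (f : {ffun 'I_n -> X} -> 'I_M1 -> 'I_M)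
      (g : 'I_M -> 'I_M1 -> {ffun 'I_n -> Z} -> {ffun 'I_n -> Xh}),
    code_distortion pZY W d f1 f g <= D + eps by exists N.
apply: filterS3 (two_stage_coding helper_a1 encoder_a eta0)
  (truncn_rate rate1) (truncn_rate rate) => n coding [M1 M1_ge M1_le] [M M_ge M_le].
have [f1 [f [g le_fg]]] := coding M1 M M1_ge M_ge.
exists M1, M; do 2!split=> //; exists f1, f, g.
by apply: le_trans le_fg _; lra.
Qed.

End Achievability.

Lemma sl_region_op_region (R : realType) (X Y Z Xh : finType)
    (pZY : Z * Y -> R) (W : Z -> X -> R) (d : X -> Xh -> R) D Rt R1 :
  is_pmf pZY -> is_channel W -> (forall x xh, 0 <= d x xh) ->
  sl_region pZY W d D Rt R1 -> op_region pZY W d D Rt R1.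
Proof.
move=> pZY_pmf W_channel d_ge0 [U [V [q [r [xhat]]]]].
move=> [q_channel [r_channel [le_D [le_R1 le_Rt]]]] e e0.
have ln2 : 0 < ln 2 :> R by rewrite ln_gt0// ltr1n.
have P_ge0 := (joint_pmf pZY_pmf W_channel q_channel r_channel).1.
exists (Rt + e / 2), (R1 + e / 2); split; last first.
  by rewrite !opprD !addNKr !normrN gtr0_norm ?divr_gt0//; lra.
apply: (sl_achievable pZY_pmf W_channel d_ge0 (xhat := xhat) q_channel r_channel).
- by apply: le_trans le_D; apply: ler_sum => -[[[[x y] z] u] v].
- by rewrite -cond_mutual_infoE// ltr_pM2r//; apply: le_lt_trans le_R1 _; lra.
- by rewrite -cond_mutual_infoE// ltr_pM2r//; apply: le_lt_trans le_Rt _; lra.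
Qed.

(** * Bounding the auxiliary alphabet *)

Section ConicCaratheodory.
Variables (R : realType) (U J : finType) (c : U -> J -> R).

Lemma exists_linear_relation (S : {pred U}) : (#|J| < #|S|)%N ->
  exists mu : U -> R, [/\ forall u, u \notin S -> mu u = 0, exists u, 0 < mu u
    & forall j, \sum_u mu u * c u j = 0].
Proof.
move=> card_S; suff [mu [muS [u mu_u] mu_c]] : exists mu : U -> R,
    [/\ forall u, u \notin S -> mu u = 0, exists u, mu u != 0
      & forall j, \sum_u mu u * c u j = 0].
  have [mu0|mu0|mu0] := ltgtP 0 (mu u); last by rewrite -mu0 eqxx in mu_u.
    by exists mu; split=> //; exists u.
  exists (fun v => - mu v); split=> [v /muS ->||j]; first by rewrite oppr0.
    by exists u; rewrite oppr_gt0.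
  by under eq_bigr do rewrite mulNr; rewrite sumrN mu_c oppr0.
pose A : 'M[R]_(#|S|, #|J|) := \matrix_(k, j) c (enum_val k) (enum_val j).
have : kermx A != 0.
  rewrite kermx_eq0 /row_free; apply/eqP => rankA.
  by have := rank_leq_col A; rewrite rankA leqNgt card_S.
move=> /rowV0Pn[v /sub_kermxP/rowP vA v_neq0].
have /card_gt0P[s Ss] : (0 < #|S|)%N by apply: leq_trans card_S.
pose mu u := if u \in S then v 0 (enum_rank_in Ss u) else 0.
exists mu; split=> [u /negbTE uS||j]; first by rewrite /mu uS.
  apply/existsP; apply: contraNT v_neq0; rewrite negb_exists => /forallP mu0.
  apply/eqP/rowP => k; rewrite mxE; have := mu0 (enum_val k).
  by rewrite negbK /mu enum_valP enum_valK_in => /eqP.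
have := vA (enum_rank j); rewrite !mxE => vA_j.
transitivity (\sum_(u in S) v 0 (enum_rank_in Ss u) * c u j).
  rewrite [RHS]big_mkcond /=; apply: eq_bigr => u _.
  by rewrite /mu; case: ifP; rewrite ?mul0r.
rewrite big_enum_val -[RHS]vA_j; apply: eq_bigr => k _.
by rewrite enum_valK_in mxE enum_rankK.
Qed.

Lemma exists_smaller_support (l : U -> R) : (forall u, 0 <= l u) ->
  (#|J| < #|support l|)%N -> exists l' : U -> R,
  [/\ forall u, 0 <= l' u, forall j, \sum_u l' u * c u j = \sum_u l u * c u j
    & support l' \proper support l].
Proof.
move=> l0 /exists_linear_relation[mu [mu_supp [u1 mu_u1] mu_c]].
pose a := [arg min_(u < u1 | 0 < mu u) (l u / mu u)]%O.
have [mu_a a_min] : 0 < mu a /\ forall u, 0 < mu u -> l a / mu a <= l u / mu u.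
  by rewrite /a; case: arg_minP => // u mu_u u_min; split.
exists (fun u => l u - l a / mu a * mu u); split=> [u|j|].
- rewrite subr_ge0; have [mu_u|mu_u] := ltP 0 (mu u).
    by rewrite -ler_pdivlMr// a_min.
  by apply: le_trans (l0 u); rewrite mulr_ge0_le0// divr_ge0// ltW.
- under eq_bigr do rewrite mulrBl -[_ * mu _ * _]mulrA.
  by rewrite sumrB -mulr_sumr mu_c mulr0 subr0.
apply/properP; split; last first.
  exists a; rewrite inE; last by rewrite divfK ?subrr ?eqxx// gt_eqF.
  by apply: contraTneq mu_a => la; rewrite mu_supp ?ltxx// inE la eqxx.
apply/fintype.subsetP => u; rewrite !inE; apply: contra => /eqP lu.
have /mu_supp -> : u \notin support l by rewrite inE lu eqxx.
by rewrite lu mulr0 subr0.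
Qed.

Lemma exists_support_le (l : U -> R) : (forall u, 0 <= l u) -> exists l' : U -> R,
  [/\ forall u, 0 <= l' u, forall j, \sum_u l' u * c u j = \sum_u l u * c u j
    & (#|support l'| <= #|J|)%N].
Proof.
have [N] := ubnP #|support l|; elim: N => // N IH in l * => lt_N l0.
have [le_J|gt_J] := leqP #|support l| #|J|; first by exists l.
have [l1 [l1_ge0 l1_c l1_l]] := exists_smaller_support l0 gt_J.
have [|l' [l'0 l'_c le_J]] := IH l1 _ l1_ge0.
  exact: leq_trans (proper_card l1_l) _.
by exists l'; split=> // j; rewrite l'_c.
Qed.

Lemma enum_support (l : U -> R) m : (forall u, 0 <= l u) -> U ->
  (#|support l| <= m)%N -> exists (e : 'I_m -> U) (b : 'I_m -> R),
  (forall k, 0 <= b k) /\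
  forall G : U -> R, \sum_k b k * G (e k) = \sum_u l u * G u.
Proof.
move=> l0 u0; rewrite cardE; set s := enum _ => le_m.
exists (fun k => nth u0 s k),
  (fun k : 'I_m => if (k < size s)%N then l (nth u0 s k) else 0).
split=> [k|G]; first by case: ifP.
transitivity (\sum_(u <- s) l u * G u).
  rewrite (big_nth u0) big_mkord [RHS](big_ord_widen m
    (fun k => l (nth u0 s k) * G (nth u0 s k)))// [RHS]big_mkcond /=.
  by apply: eq_bigr => k _; case: ifP; rewrite ?mul0r.
rewrite big_enum big_mkcond; apply: eq_bigr => u _.
by rewrite inE; case: eqP => //= ->; rewrite mul0r.
Qed.

Lemma conic_caratheodory (l : U -> R) : (forall u, 0 <= l u) -> U ->
  exists (e : 'I_#|J| -> U) (b : 'I_#|J| -> R), (forall k, 0 <= b k) /\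
  forall j, \sum_k b k * c (e k) j = \sum_u l u * c u j.
Proof.
move=> l0 u0; have [l' [l'0 l'_c le_J]] := exists_support_le l0.
have [e [b [b0 eb]]] := enum_support l'0 u0 le_J.
by exists e, b; split=> // j; rewrite (eb (c^~ j)).
Qed.

End ConicCaratheodory.

Section Budget.
Variables (R : realType) (X Y Z Xh : finType).
Variables (pZY : Z * Y -> R) (W : Z -> X -> R) (d : X -> Xh -> R).
Hypotheses (pZY_pmf : is_pmf pZY) (W_channel : is_channel W).
Local Notation strategy := {ffun Z -> Xh}.
Local Notation joint := (joint pZY W).

(* The contribution of one letter of [U], of weight [q y] given [y], to the
   quantities constrained by the single-letter region; [I(U;Y|X)] is split as
   [H(Y|X) - H(Y|X,U)]. *)
Definition letter_costs (q : Y -> R) (r : X -> strategy -> R) : 3.-tuple R :=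
  let P := joint (fun y (_ : unit) => q y) (fun xu => r xu.1) in
  [tuple - cond_entropy P rvY rvX; cond_info P rvX rvV rvZ;
         expect P (fun t => d (rvX t) (rvV t (rvZ t)))].

Definition within_budget (U : finType) (a : 'I_3 -> R)
    (q : Y -> U -> R) (r : X * U -> strategy -> R) : Prop :=
  [/\ is_channel q, is_channel r & forall k,
    \sum_u tnth (letter_costs (q^~ u) (fun x => r (x, u))) k <= a k].

Definition equivocation : R :=
  cond_entropy (source pZY W) (fun t => t.1.2) (fun t => t.1.1).

(* The rates [Rt] and [R1] are in nats. *)
Definition budget (D Rt R1 : R) : 'I_3 -> R :=
  tnth [tuple R1 - equivocation; Rt; D].

Lemma letter_costsZ b q r k :
  0 <= b -> (forall y, 0 <= q y) -> (forall x v, 0 <= r x v) ->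
  tnth (letter_costs (fun y => b * q y) r) k = b * tnth (letter_costs q r) k.
Proof.
move=> b0 q0 r0; pose P := joint (fun y (_ : unit) => q y) (fun xu => r xu.1).
have P_ge0 t : 0 <= P t by apply: joint_ge0.
rewrite /letter_costs -/P.
have -> : joint (fun y (_ : unit) => b * q y) (fun xu => r xu.1) = (fun t => b * P t).
  by apply/funext => -[[[[x y] z] u] v]; rewrite /P /=; ring.
case: k => -[|[|[|//]]] lt_k; rewrite !(tnth_nth 0) /=.
- by rewrite cond_entropyZ// mulrN.
- by rewrite cond_infoZ.
- by rewrite /expect mulr_sumr; apply: eq_bigr => t _; rewrite mulrA.
Qed.

Section Sum.
Variables (U T : finType) (q : Y -> U -> R) (r : X * U -> strategy -> R).
Variables (P : T -> R) (A : T -> X) (B : T -> Y) (C : T -> Z) (D : T -> U).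
Variable E : T -> strategy.
Hypothesis law_ABCDE : law P [% A, B, C, D, E] =1 joint q r.

Lemma sum_letter_costs k :
  \sum_u tnth (letter_costs (q^~ u) (fun x => r (x, u))) k =
  tnth [tuple - cond_entropy P B [% A, D]; cond_info P A E [% D, C];
              expect P (fun t => d (A t) (E t (C t)))] k.
Proof.
have jointE u : joint (fun y (_ : unit) => q y u) (fun xu => r (xu.1, u)) =
    law (slice P D u) [% A, B, C, fun=> tt, E].
  apply/funext => -[[[[x y] z] []] v]; rewrite law_slice.
  transitivity (law P [% A, B, C, D, E] (x, y, z, u, v)); first by rewrite law_ABCDE.
  by apply: eq_law; rv_congr.
rewrite /letter_costs; under eq_bigr => u _ do rewrite jointE.
case: k => -[|[|[|//]]] lt_k; rewrite !(tnth_nth 0) /=;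
  under eq_bigr => u _ do rewrite (tnth_nth 0) /=.
- rewrite sumrN cond_entropy_slices; congr (- _); apply: eq_bigr => u _.
  by rewrite cond_entropy_law.
- transitivity (cond_info P A E [% C, D]); last by apply: eq_cond_info; rv_congr.
  by rewrite cond_info_slices; apply: eq_bigr => u _; rewrite cond_info_law.
under eq_bigr do rewrite expect_law.
rewrite exchange_big; apply: eq_bigr => t _ /=.
rewrite -mulr_suml; congr (_ * _).
rewrite (bigD1 (D t))//= big1 ?addr0 /slice ?eqxx// => u.
by rewrite eq_sym => /negbTE ->.
Qed.

End Sum.

Lemma equivocationE (T : finType) (P : T -> R) (A : T -> X) (B : T -> Y) (C : T -> Z) :
  law P [% A, B, C] =1 source pZY W -> equivocation = cond_entropy P B A.
Proof.
by move=> /funext lawABC; rewrite /equivocation -lawABC cond_entropy_law.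
Qed.

Lemma within_budget_sl_region (U : finType) D Rt R1
    (q : Y -> U -> R) (r : X * U -> strategy -> R) :
  within_budget (budget D (Rt * ln 2) (R1 * ln 2)) q r -> sl_region pZY W d D Rt R1.
Proof.
move=> [q_channel r_channel le_budget]; set P := joint q r.
have P_ge0 := (joint_pmf pZY_pmf W_channel q_channel r_channel).1.
have lawP : law P [% rvX, rvY, rvZ, rvU, rvV] =1 P.
  by move=> [[[[x y] z] u] v]; rewrite /law (big_pred1 (x, y, z, u, v)).
have ln2 : 0 < ln 2 :> R by rewrite ln_gt0// ltr1n.
exists U, strategy, q, r, (fun _ (v : strategy) z => v z).
do 2!split=> //; split; [|split].
- have := le_budget 2; rewrite (sum_letter_costs lawP) /budget !(tnth_nth 0) /=.
  by apply: le_trans; apply: ler_sum => -[[[[x y] z] u] v].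
- have := le_budget 0; rewrite (sum_letter_costs lawP) /budget !(tnth_nth 0) /=.
  rewrite (equivocationE (law_joint_XYZ pZY W q_channel r_channel)) lerBrDl.
  by rewrite -cond_info_entropy -cond_mutual_infoE// ler_pM2r.
- have := le_budget 1; rewrite (sum_letter_costs lawP) /budget !(tnth_nth 0) /=.
  by rewrite -cond_mutual_infoE// ler_pM2r.
Qed.

Lemma within_budgetW (U : finType) a b (q : Y -> U -> R) (r : X * U -> strategy -> R) :
  (forall k, a k <= b k) -> within_budget a q r -> within_budget b q r.
Proof.
move=> le_ab [q_channel r_channel le_a]; split=> // k.
exact: le_trans (le_a k) (le_ab k).
Qed.

(* Time sharing: the index [i] becomes part of the auxiliary variable. *)
Lemma within_budget_average (I U : finType) (a : I -> 'I_3 -> R)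
    (q : I -> Y -> U -> R) (r : I -> X * U -> strategy -> R) : (0 < #|I|)%N ->
  (forall i, within_budget (a i) (q i) (r i)) ->
  within_budget (fun k => #|I|%:R^-1 * \sum_i a i k)
    (fun y (iu : I * U) => #|I|%:R^-1 * q iu.1 y iu.2)
    (fun xiu => r xiu.2.1 (xiu.1, xiu.2.2)).
Proof.
move=> I_gt0 within; have N0 : 0 < #|I|%:R :> R by rewrite ltr0n.
have q0 i y u : 0 <= q i y u.
  by have [q_channel _ _] := within i; apply: (q_channel y).1.
have r0 i xu v : 0 <= r i xu v.
  by have [_ r_channel _] := within i; apply: (r_channel xu).1.
split=> [y|[x [i u]]|k].
- split=> [iu|]; first by rewrite mulr_ge0// invr_ge0 ltW.
  rewrite sum_pair; under eq_bigr => i _ do rewrite -mulr_sumr.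
  rewrite (eq_bigr (fun=> #|I|%:R^-1)) => [|i _]; last first.
    by have [q_channel _ _] := within i; rewrite (q_channel y).2 mulr1.
  by rewrite sumr_const -[_ *+ _]mulr_natr mulVf// gt_eqF.
- by have [_ r_channel _] := within i; apply: r_channel.
rewrite sum_pair mulr_sumr /=.
apply: ler_sum => i _; have [_ _ /(_ k) le_a] := within i.
under eq_bigr do rewrite letter_costsZ ?invr_ge0 ?ltW//.
by rewrite -mulr_sumr ler_wpM2l// invr_ge0 ltW.
Qed.

(* One linear constraint for each [y], as the rows of [q] sum to one, and one for
   each letter cost. *)
Lemma within_budget_card (U : finType) (a : 'I_3 -> R)
    (q : Y -> U -> R) (r : X * U -> strategy -> R) : U ->
  within_budget a q r ->
  exists (q' : Y -> 'I_#|{: Y + 'I_3}| -> R) r', within_budget a q' r'.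
Proof.
move=> u0 [q_channel r_channel le_a].
have q0 y u : 0 <= q y u := (q_channel y).1 u.
have r0 xu v : 0 <= r xu v := (r_channel xu).1 v.
pose c u (j : Y + 'I_3) := match j with
  | inl y => q y u
  | inr k => tnth (letter_costs (q^~ u) (fun x => r (x, u))) k
  end.
have [e [b [b0 eb]]] := conic_caratheodory c (fun=> ler01) u0.
exists (fun y k => b k * q y (e k)), (fun xk => r (xk.1, e xk.2)).
split=> [y|[x k]|k]; last 1 first.
- apply: le_trans (le_a k); under eq_bigr do rewrite letter_costsZ//.
  by rewrite (eb (inr k)); under eq_bigr do rewrite mul1r.
- split=> [k|]; first by rewrite mulr_ge0.
  by rewrite (eb (inl y)) /=; under eq_bigr do rewrite mul1r; exact: (q_channel y).2.
- exact: r_channel.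
Qed.

End Budget.

(** * Closedness *)

Section Continuity.
Variable R : realType.

Lemma xlnx_le_sqrt (t : R) : 0 <= t <= 1 -> 0 <= t * - ln t <= 2 * Num.sqrt t.
Proof.
move=> /andP[t0 t1]; rewrite mulr_ge0 ?oppr_ge0 ?ln_le0//=.
move: t0; rewrite le_eqVlt => /predU1P[<-|t0]; first by rewrite mul0r sqrtr0 mulr0.
pose s := Num.sqrt t; have s0 : 0 < s by rewrite sqrtr_gt0.
have ts : t = s * s by rewrite -expr2 sqr_sqrtr// ltW.
have si0 : 0 < s^-1 by rewrite invr_gt0.
have := (ln_leif si0).1; rewrite -/s ts lnM ?posrE// lnV ?posrE// => le_ln.
have : s * s * - ln s <= s * s * (s^-1 - 1) by rewrite ler_wpM2l// mulr_ge0 ?ltW.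
have -> : s * s * (s^-1 - 1) = s - s * s by field; rewrite gt_eqF.
by have := mulr_gt0 s0 s0; lra.
Qed.

Lemma xlnx_continuous (x : R) : 0 <= x -> {for x, continuous (fun t : R => t * - ln t)}.
Proof.
rewrite le_eqVlt => /predU1P[<-|x0]; last first.
  apply: (@continuousM _ _ id (fun t => - ln t)); first exact: cvg_id.
  by apply: cvgN; apply: continuous_ln.
suff : t * - ln t @[t --> (0 : R)] --> (0 : R).
  by rewrite -[X in _ --> X](mul0r (- ln 0)).
apply/cvgr0Pnorm_le => e e0; near=> t.
have [t0|t0] := leP t 0; first by rewrite ln0// oppr0 mulr0 normr0 ltW.
have t1 : t < 1 by near: t; apply: lt_nbhsl.
have /andP[xlnx_ge0 xlnx_le] : 0 <= t * - ln t <= 2 * Num.sqrt t.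
  by apply: xlnx_le_sqrt; rewrite !ltW.
rewrite ger0_norm//; apply: le_trans xlnx_le _; rewrite mulrC -ler_pdivlMr//.
have e2 : 0 <= e / 2 by rewrite divr_ge0// ltW.
rewrite -ler_sqr ?nnegrE ?sqrtr_ge0// sqr_sqrtr ltW//.
by near: t; apply: lt_nbhsl; rewrite exprn_gt0// divr_gt0.
Unshelve. all: by end_near. Qed.

Section Limits.
Variables (K : Type) (G : set_system K).
Context {G_filter : ProperFilter G}.

Lemma cvg_fin_sum (I : finType) (E : pred I) (f : K -> I -> R) (l : I -> R) :
  (forall i, f k i @[k --> G] --> l i) ->
  \sum_(i | E i) f k i @[k --> G] --> \sum_(i | E i) l i.
Proof. by move=> fl; apply: cvg_big => [|i _]; [exact: add_continuous | exact: fl]. Qed.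

Section Functionals.
Variables (T : finType) (Pk : K -> T -> R) (P : T -> R).
Hypothesis Pk_ge0 : forall k t, 0 <= Pk k t.
Hypothesis cvg_P : forall t, Pk k t @[k --> G] --> P t.

Let P_ge0 t : 0 <= P t.
Proof. by apply: (cvgr_to_ge (@cvg_P t)); apply: nearW. Qed.

Lemma cvg_expect (F : T -> R) : expect (Pk k) F @[k --> G] --> expect P F.
Proof. by apply: cvg_fin_sum => t; apply: cvgM; [exact: cvg_P | exact: cvg_cst]. Qed.

Lemma cvg_entropy (TA : finType) (A : T -> TA) :
  entropy (Pk k) A @[k --> G] --> entropy P A.
Proof.
have entropyE (Q : T -> R) : entropy Q A = \sum_a law Q A a * - ln (law Q A a).
  by rewrite -/(expect (law Q A) (fun a => - ln (law Q A a))) expect_law.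
rewrite entropyE; under eq_fun do rewrite entropyE.
apply: cvg_fin_sum => a.
apply: (continuous_cvg _ (xlnx_continuous (law_ge0 P_ge0 A a))).
exact: cvg_fin_sum.
Qed.

Lemma cvg_cond_entropy (TA TC : finType) (A : T -> TA) (C : T -> TC) :
  cond_entropy (Pk k) A C @[k --> G] --> cond_entropy P A C.
Proof. by apply: cvgB; apply: cvg_entropy. Qed.

Lemma cvg_cond_info (TA TB TC : finType) (A : T -> TA) (B : T -> TB) (C : T -> TC) :
  cond_info (Pk k) A B C @[k --> G] --> cond_info P A B C.
Proof.
rewrite cond_info_entropy; under eq_fun do rewrite cond_info_entropy.
by apply: cvgB; apply: cvg_cond_entropy.
Qed.

End Functionals.
End Limits.

Section Ultrafilter.
Variables (K : Type) (G : set_system K).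
Context {G_ultra : UltraFilter G}.

Lemma ultra_cvg_unit_interval (f : K -> R) : (forall k, 0 <= f k <= 1) ->
  exists l : R, f k @[k --> G] --> l.
Proof.
move=> f01; have [l [_ l_cluster]] : `[(0 : R), 1] `&` cluster (f @ G) !=set0.
  apply: (@segment_compact R 0 1); suff : G (f @^-1` `[0, 1]) by [].
  by apply: filterE => k; rewrite /= in_itv; exact: f01.
exists l => B /= Bl; have [//|notB] := in_ultra_setVsetC (f @^-1` B) G_ultra.
by have [] := l_cluster (~` B) B notB Bl; rewrite setICl => ? [].
Qed.

Lemma ultra_cvg_channel (A B : finType) (q : K -> A -> B -> R) :
  (forall k, is_channel (q k)) ->
  exists2 l : A -> B -> R, is_channel l & forall a b, q k a b @[k --> G] --> l a b.
Proof.
move=> q_channel; have q01 k a b : 0 <= q k a b <= 1.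
  have [q0 q1] := q_channel k a.
  by rewrite q0 -q1 (bigD1 b)//= lerDl sumr_ge0.
have [l cvg_l] := choice (fun ab : A * B => ultra_cvg_unit_interval
  (fun k => q01 k ab.1 ab.2)).
exists (fun a b => l (a, b)) => [a|a b]; last exact: cvg_l (a, b).
split=> [b|].
  by apply: (cvgr_to_ge (cvg_l (a, b))); apply: nearW => k; have /andP[] := q01 k a b.
have cvg_sum : \sum_b q k a b @[k --> G] --> \sum_b l (a, b).
  by apply: cvg_fin_sum => b; exact: cvg_l (a, b).
apply: (cvg_unique _ cvg_sum); first exact: norm_hausdorff.
by apply: cvg_near_cst; apply: nearW => k; exact: (q_channel k a).2.
Qed.

End Ultrafilter.
End Continuity.

Section Closed.
Variables (R : realType) (X Y Z Xh : finType).
Variables (pZY : Z * Y -> R) (W : Z -> X -> R) (d : X -> Xh -> R).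
Hypotheses (pZY_pmf : is_pmf pZY) (W_channel : is_channel W).
Local Notation strategy := {ffun Z -> Xh}.

Lemma cvg_letter_costs (K : Type) (G : set_system K)
    (G_proper : ProperFilter G) (qk : K -> Y -> R)
    (rk : K -> X -> strategy -> R) q r j :
  (forall k y, 0 <= qk k y) -> (forall k x v, 0 <= rk k x v) ->
  (forall y, qk k y @[k --> G] --> q y) ->
  (forall x v, rk k x v @[k --> G] --> r x v) ->
  tnth (letter_costs pZY W d (qk k) (rk k)) j @[k --> G] -->
  tnth (letter_costs pZY W d q r) j.
Proof.
move=> qk0 rk0 cvg_q cvg_r.
have joint0 k t : 0 <= joint pZY W (fun y (_ : unit) => qk k y)
    (fun xu => rk k xu.1) t by apply: joint_ge0.
have cvg_joint t :
    joint pZY W (fun y (_ : unit) => qk k y) (fun xu => rk k xu.1) t @[k --> G] -->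
    joint pZY W (fun y (_ : unit) => q y) (fun xu => r xu.1) t.
  case: t => [[[[x y] z] u] v]; apply: cvgM; last exact: cvg_r.
  by apply: cvgM; [exact: cvg_cst | exact: cvg_q].
case: j => -[|[|[|//]]] lt_j; rewrite !(tnth_nth 0) /=;
  under eq_fun do rewrite (tnth_nth 0) /=.
- by apply: cvgN; apply: cvg_cond_entropy.
- exact: cvg_cond_info.
- exact: cvg_expect.
Qed.

(* Limits along a nonprincipal ultrafilter replace the extraction of convergent
   subsequences of channels. *)
Lemma within_budget_closed (U : finType) (a : 'I_3 -> R) :
  (forall e, 0 < e -> exists (q : Y -> U -> R) (r : X * U -> strategy -> R),
     within_budget pZY W d (fun k => a k + e) q r) ->
  exists (q : Y -> U -> R) (r : X * U -> strategy -> R), within_budget pZY W d a q r.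
Proof.
move=> near_a.
have {}near_a n : exists qr : (Y -> U -> R) * (X * U -> strategy -> R),
    within_budget pZY W d (fun k => a k + n.+1%:R^-1) qr.1 qr.2.
  by have [|q [r]] := near_a n.+1%:R^-1; [rewrite invr_gt0 | exists (q, r)].
have [qr within] := choice near_a.
have [G [G_ultra subG]] := ultraFilterLemma (F := \oo) _.
have cvg0 : (n.+1%:R^-1 : R) @[n --> G] --> (0 : R).
  by apply: cvg_trans (@cvg_harmonic R) => A /=; apply: subG.
have q_channel n : is_channel (qr n).1 by have [] := within n.
have r_channel n : is_channel (qr n).2 by have [] := within n.
have [q q_lim cvg_q] := ultra_cvg_channel q_channel.
have [r r_lim cvg_r] := ultra_cvg_channel r_channel.
exists q, r; split=> // k; rewrite -[a k]addr0.
apply: (ler_cvg_to _ (cvgD (cvg_cst (a k)) cvg0)); last first.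
  by apply: nearW => n; have [_ _] := within n; apply.
apply: cvg_fin_sum => u; apply: cvg_letter_costs => *.
- exact: (q_channel _ _).1.
- exact: (r_channel _ _).1.
- exact: cvg_q.
- exact: cvg_r.
Qed.

End Closed.

(** * Converse *)

Section Estimation.
Variables (R : realType) (T : finType) (P : T -> R).
Hypothesis P_pmf : is_pmf P.
Implicit Types TA TB TC S : finType.

Lemma function_of_factor S TA (F : T -> S) (A : T -> TA) :
  function_of F A -> exists g : TA -> S, forall t, F t = g (A t).
Proof.
move=> FA; have t0 := pmf_inhabited P_pmf.
exists (fun a => if [pick t | A t == a] is Some t then F t else F t0) => t.
by case: pickP => [t' /eqP/FA-> //|/(_ t)]; rewrite eqxx.
Qed.

Lemma exists_best_estimate S TA TB TC (A : T -> TA) (B : T -> TB) (C : T -> TC)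
    (cost : TB -> S -> R) (F : T -> S) :
  cond_indep P A B C -> function_of F [% A, C] ->
  exists h : TC -> S, expect P (fun t => cost (B t) (h (C t))) <=
                      expect P (fun t => cost (B t) (F t)).
Proof.
move=> indep /function_of_factor[g Fg]; have t0 := pmf_inhabited P_pmf.
pose cond_cost c s := expect (cond_law P B C c) (cost^~ s).
pose h c := [arg min_(s < F t0) cond_cost c s]%O.
have h_min c s : cond_cost c (h c) <= cond_cost c s.
  by rewrite /h; case: arg_minP => // s' _; apply.
exists h; rewrite (expect_cond_indep P_pmf (fun _ c b => cost b (h c)) indep).
have -> : expect P (fun t => cost (B t) (F t)) =
    expect P (fun t => cond_cost (C t) (g (A t, C t))).
  rewrite -(expect_cond_indep P_pmf (fun a c b => cost b (g (a, c))) indep).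
  by apply: eq_bigr => t _; rewrite Fg.
by apply: ler_expect => [t|t]; [exact: P_pmf.1 | exact: h_min].
Qed.

End Estimation.

Section LetterBudget.
Variables (R : realType) (X Y Z Xh T U : finType).
Variables (pZY : Z * Y -> R) (W : Z -> X -> R) (d : X -> Xh -> R) (P : T -> R).
Hypothesis P_pmf : is_pmf P.
Let P_ge0 := P_pmf.1.
Variables (A : T -> X) (B : T -> Y) (C : T -> Z) (D : T -> U).
Variable E : T -> {ffun Z -> Xh}.
Hypothesis law_ABC : law P [% A, B, C] =1 source pZY W.
Hypothesis AC_D_given_B : cond_indep P [% A, C] D B.
Hypothesis BC_E_given_AD : cond_indep P [% B, C] E [% A, D].

Lemma law_joint_of_cond_indep :
  law P [% A, B, C, D, E] =1 joint pZY W (cond_law P D B) (cond_law P E [% A, D]).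
Proof.
move=> [[[[x y] z] u] v].
transitivity (law P [% [% B, C], E, [% A, D]] ((y, z), v, (x, u))).
  by apply: eq_law; rv_congr.
rewrite cond_indep_law//; congr (_ * _).
transitivity (law P [% [% A, C], D, B] ((x, z), u, y)).
  by apply: eq_law; rv_congr.
rewrite cond_indep_law// -[pXYZ _ _ _ _ _]/(source pZY W (x, y, z)) -law_ABC.
by congr (_ * _); apply: eq_law; rv_congr.
Qed.

Lemma within_budget_of_cond_indep :
  within_budget pZY W d
    (budget pZY W (expect P (fun t => d (A t) (E t (C t))))
      (cond_info P A E [% D, C]) (cond_info P D B A))
    (cond_law P D B) (cond_law P E [% A, D]).
Proof.
split=> [||k]; try exact: cond_law_channel.
rewrite (sum_letter_costs d law_joint_of_cond_indep) /budget.
rewrite (equivocationE law_ABC); case: k => -[|[|[|//]]] lt_k;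
  by rewrite !(tnth_nth 0) //= cond_info_entropy addrAC subrr sub0r.
Qed.

End LetterBudget.

Section Restriction.
Variables (R : realType) (I T : finType).

Definition rv_restrict (TA : Type) (S : pred I) (A : T -> TA) :
    {ffun I -> T} -> {ffun I -> option TA} :=
  rv_family (fun i t => if S i then Some (A t) else None).

Lemma rv_restrictP (TA : Type) (S : pred I) (A : T -> TA) w w' :
  rv_restrict S A w = rv_restrict S A w' <-> forall i, S i -> A (w i) = A (w' i).
Proof.
rewrite rv_familyP; split=> [e i Si|e i]; last first.
  by rewrite ffunE; case: ifP => // Si; rewrite e.
by have := e i; rewrite ffunE Si => -[].
Qed.

Lemma coord_indep_others (p : T -> R) i : is_pmf p ->
  cond_indep (iid p) (rv_restrict (predC1 i) id) (fun w : {ffun I -> T} => w i)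
    (fun=> tt).
Proof.
move=> p_pmf; have p_ge0 := p_pmf.1.
have iid_ge0 : forall w : {ffun I -> T}, 0 <= iid p w := (iid_pmf I p_pmf).1.
have indep j : cond_indep p (fun t => if predC1 i j then Some (id t) else None)
    (fun t => if j == i then Some t else None) (fun=> tt).
  rewrite /=; case: eqP => _ /=; last apply: cond_indepC => //;
    exact: function_cond_indep.
apply: (cond_indepW iid_ge0 (cond_indep_rv_family indep)) => // w w'.
  by case.
by case=> /rv_familyP/(_ i); rewrite ffunE eqxx => -[].
Qed.

End Restriction.

Section Code.
Variables (R : realType) (X Y Z : finType).
Variables (pZY : Z * Y -> R) (W : Z -> X -> R).
Hypotheses (pZY_pmf : is_pmf pZY) (W_channel : is_channel W).
Local Notation letterX := (fun t : X * Y * Z => t.1.1).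
Local Notation letterY := (fun t : X * Y * Z => t.1.2).
Local Notation letterZ := (fun t : X * Y * Z => t.2).

Lemma source_markov : cond_indep (source pZY W) letterX letterY letterZ.
Proof.
apply: (cond_indep_factor (F := fun x z => W z x)
  (G := fun y z => pZY (z, y))) => x y z.
by rewrite mulrC /law (big_pred1 (x, y, z)).
Qed.

Variable n : nat.
Local Notation Om := {ffun 'I_n -> X * Y * Z}.
Local Notation P := (iid (source pZY W) : Om -> R).
Let letter_pmf : is_pmf (source pZY W) := source_pmf pZY_pmf W_channel.
Let P_pmf : is_pmf P := iid_pmf 'I_n letter_pmf.
Let P_ge0 := P_pmf.1.

Lemma X_restrict_markov (S : pred 'I_n) :
  cond_indep P (rv_restrict S letterX)
    [% rv_seq letterY, rv_seq letterZ, rv_restrict (predC S) letterX]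
    (rv_restrict S letterZ).
Proof.
pose rest i (t : X * Y * Z) := (t.1.2, t.2, if predC S i then Some t.1.1 else None).
have indep i : cond_indep (source pZY W)
    (fun t => if S i then Some t.1.1 else None) (rest i)
    (fun t => if S i then Some t.2 else None).
  rewrite /rest /=; case: (S i) => /=; last first.
    exact: (function_cond_indep letter_pmf.1).
  by apply: (cond_indepW letter_pmf.1 source_markov); rv_congr.
apply: (cond_indepW P_ge0 (cond_indep_rv_family indep)) => // w w'.
- by case.
- by case.
case=> /rv_familyP e _; congr (_, _, _).
- by apply/rv_familyP => i; have := e i; rewrite !ffunE => -[].
- by apply/rv_familyP => i; have := e i; rewrite !ffunE => -[].
- by apply/rv_familyP => i; have := e i; rewrite !ffunE => -[].
Qed.

Definition coordX (i : 'I_n) (w : Om) := (w i).1.1.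
Definition coordY (i : 'I_n) (w : Om) := (w i).1.2.
Definition coordZ (i : 'I_n) (w : Om) := (w i).2.

Lemma law_coord i : law P [% coordX i, coordY i, coordZ i] =1 source pZY W.
Proof.
move=> t; rewrite -(law_iid_coord letter_pmf i); apply: eq_law => w.
by rewrite /rv_pair /coordX /coordY /coordZ; case: (w i) => [[]].
Qed.

Variables (M1 M : nat).
Variables (f1 : {ffun 'I_n -> Y} -> 'I_M1) (f : {ffun 'I_n -> X} -> 'I_M1 -> 'I_M).

Definition helper_message (w : Om) := f1 (rv_seq letterY w).
Definition encoder_message (w : Om) := f (rv_seq letterX w) (helper_message w).

(* [U_i = (T_1, Z^(i-1), X_(i+1)^n)]. *)
Definition auxiliary (i : 'I_n) :=
  [% helper_message, rv_restrict (fun j : 'I_n => (j < i)%N) letterZ,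
     rv_restrict (fun j : 'I_n => (i < j)%N) letterX].

Definition past (k : nat) :=
  [% rv_seq letterX : Om -> _,
     rv_restrict (fun j : 'I_n => (j < k)%N) [% letterY, letterZ]].

Definition future (k : nat) :=
  [% helper_message, rv_seq letterZ, rv_restrict (fun j : 'I_n => (k <= j)%N) letterX].

Lemma auxiliary_congr (i : 'I_n) w w' :
  helper_message w = helper_message w' ->
  (forall j : 'I_n, (j < i)%N -> coordZ j w = coordZ j w') ->
  (forall j : 'I_n, (i < j)%N -> coordX j w = coordX j w') ->
  auxiliary i w = auxiliary i w'.
Proof. by move=> eT eZ eX; congr (_, _, _); [|apply/rv_restrictP..]. Qed.

Lemma helper_message_congr w w' :
  (forall j, coordY j w = coordY j w') -> helper_message w = helper_message w'.
Proof. by move=> eY; congr f1; apply/rv_seqP. Qed.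

Lemma encoder_message_congr w w' : helper_message w = helper_message w' ->
  (forall j, coordX j w = coordX j w') -> encoder_message w = encoder_message w'.
Proof. by move=> eT eX; congr f => //; apply/rv_seqP. Qed.

Section Letter.
Variable i : 'I_n.

Lemma XZ_auxiliary_given_Y :
  cond_indep P [% coordX i, coordZ i] (auxiliary i) (coordY i).
Proof.
apply: (cond_indepC P_ge0).
apply: (cond_indepW P_ge0 (coord_indep_others i letter_pmf)) => // w w'.
- by case; rewrite /coordY => ->.
- case=> /rv_restrictP others eY.
  apply: auxiliary_congr => [|j ji|j ij].
  + apply: helper_message_congr => j; have [->//|ji] := eqVneq j i.
    by rewrite /coordY others.
  + by rewrite /coordZ others//= neq_ltn ji.
  + by rewrite /coordX others//= neq_ltn ij orbT.
- by case; rewrite /rv_pair /coordX /coordZ => ->.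
Qed.

Lemma Y_past_given_X : cond_indep P (coordY i) (past i) (coordX i).
Proof.
apply: (cond_indepC P_ge0).
apply: (cond_indepW P_ge0 (coord_indep_others i letter_pmf)) => // w w'.
- by case; rewrite /coordX => ->.
- case=> /rv_restrictP others eX; congr (_, _).
    by apply/rv_seqP => j; have [->//|ji] := eqVneq j i; rewrite others.
  by apply/rv_restrictP => j ji; rewrite others//= neq_ltn ji.
- by case; rewrite /coordY => ->.
Qed.

Lemma YZ_strategy_given_X_auxiliary (TV : finType) (V : Om -> TV) :
  function_of V [% encoder_message, auxiliary i] ->
  cond_indep P [% coordY i, coordZ i] V [% coordX i, auxiliary i].
Proof.
move=> VTU; apply/(cond_indepC P_ge0).
apply: (cond_indepW P_ge0 (X_restrict_markov (fun j => (j < i)%N))) => w w'.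
- by case.
- case=> /rv_seqP eY /rv_seqP eZ /rv_restrictP eX _; congr (_, _).
    by apply: eX; rewrite /= ltnn.
  apply: auxiliary_congr => [|j _|j ij]; first exact: helper_message_congr.
    exact: eZ.
  by apply: eX; rewrite /= -leqNgt ltnW.
- case=> /rv_restrictP eX eXi eT eZ /[dup] eX' /rv_restrictP eX_after.
  apply: VTU; congr (_, _); last by congr (_, _, _).
  apply: encoder_message_congr => // j.
  by have [/eX|/eX_after|/val_inj->] := ltngtP j i.
- by case=> /rv_seqP eY /rv_seqP eZ _ _; congr (_, _); [exact: eY | exact: eZ].
Qed.

Lemma X_prefix_future_given_auxiliary :
  cond_indep P (rv_restrict (fun j : 'I_n => (j <= i)%N) letterX) (future i.+1)
    [% auxiliary i, coordZ i].
Proof.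
apply: (cond_indepW P_ge0 (X_restrict_markov (fun j => (j <= i)%N))) => w w'.
- case=> _ /rv_restrictP eZ _ eZi; apply/rv_restrictP => j.
  by rewrite leq_eqVlt => /predU1P[/val_inj->|/eZ].
- case=> /rv_seqP eY /rv_seqP eZ /rv_restrictP eX _.
  congr (_, _); last exact: eZ.
  apply: auxiliary_congr => [|j _|j ij]; first exact: helper_message_congr.
    exact: eZ.
  by apply: eX; rewrite /= -ltnNge.
- by case.
- case=> /rv_seqP eY eZ /rv_restrictP eX _; congr (_, _, _) => //.
    exact: helper_message_congr.
  by apply/rv_restrictP => j ij; apply: eX; rewrite /= -ltnNge.
Qed.

Lemma X_future_given_auxiliary :
  cond_indep P (coordX i) (future i.+1) [% auxiliary i, coordZ i].
Proof.
apply: (cond_indepW P_ge0 X_prefix_future_given_auxiliary) => // w w'.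
- by move/(congr1 snd).
- by case=> /rv_restrictP eX *; apply: eX.
- by move/(congr1 fst).
Qed.

Lemma future_X_given_messages : cond_indep P (future i.+1) (coordX i)
  [% encoder_message, [% auxiliary i, coordZ i]].
Proof.
apply: (cond_indepW P_ge0 (cond_indepC P_ge0 X_prefix_future_given_auxiliary)) => w w'.
- by move/(congr1 snd).
- case=> /rv_restrictP eX eT eZ /[dup] eX' /rv_restrictP eX_after eZi.
  congr (_, (_, _)) => //; last by congr (_, _, _).
  apply: encoder_message_congr => // j.
  by have [/eX|/eX_after] := leqP j i.
- by move/(congr1 fst).
- by case=> /rv_restrictP eX *; apply: eX.
Qed.

Lemma exists_strategy (Xh : finType) (d : X -> Xh -> R)
    (g : 'I_M -> 'I_M1 -> {ffun 'I_n -> Z} -> {ffun 'I_n -> Xh}) :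
  exists V : Om -> {ffun Z -> Xh}, function_of V [% encoder_message, auxiliary i] /\
    expect P (fun w => d (coordX i w) (V w (coordZ i w))) <=
    expect P (fun w => d (coordX i w)
      (g (encoder_message w) (helper_message w) (rv_seq letterZ w) i)).
Proof.
pose estimate w := g (encoder_message w) (helper_message w) (rv_seq letterZ w) i.
have [|h le_h] := exists_best_estimate P_pmf d (F := estimate) future_X_given_messages.
  by move=> w w' [eT1 eZ _ eT _ _ _]; rewrite /estimate eT1 eZ eT.
exists (fun w => [ffun z => h (encoder_message w, (auxiliary i w, z))]); split.
  by move=> w w' [eT1 eT eZ eX]; rewrite eT1 /auxiliary /rv_pair eT eZ eX.
by apply: le_trans le_h; apply: ler_expect => // w; rewrite ffunE.
Qed.

End Letter.

Lemma helper_rate : \sum_i cond_info P (auxiliary i) (coordY i) (coordX i) <= ln M1%:R.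
Proof.
pose helper_entropy k := cond_entropy P helper_message (past k).
apply: (@le_trans _ _ (\sum_(i < n) - (helper_entropy i.+1 - helper_entropy i))).
  apply: ler_sum => i _; rewrite cond_infoC opprB.
  apply: (cond_info_le_entropy_drop P_ge0 (Y_past_given_X i)) => w w'.
  - by case=> /rv_seqP eX _; apply: eX.
  - case=> eT /rv_seqP eX /rv_restrictP eYZ; apply: auxiliary_congr => // j ji.
      by have [] := eYZ j ji.
    exact: eX.
  - case=> eX /rv_restrictP eYZ; congr (_, (_, _)) => //.
      by have [] := eYZ i (leqnn _).
    by apply/rv_restrictP => j ji; apply: eYZ; apply: ltnW.
rewrite sumrN -(big_mkord xpredT (fun k => helper_entropy k.+1 - helper_entropy k)).
rewrite telescope_sumr// opprB -[M1 in leRHS]card_ord.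
apply: le_trans (entropy_le_ln_card P_pmf helper_message).
have := cond_entropy_ge0 P_ge0 helper_message (past n).
have := cond_entropy_le P_pmf helper_message (past 0).
by rewrite /helper_entropy; lra.
Qed.

Lemma encoder_rate (TV : finType) (V : 'I_n -> Om -> TV) :
  (forall i, function_of (V i) [% encoder_message, auxiliary i]) ->
  \sum_i cond_info P (coordX i) (V i) [% auxiliary i, coordZ i] <= ln M%:R.
Proof.
move=> VTU; pose encoder_entropy k := cond_entropy P encoder_message (future k).
apply: (@le_trans _ _ (\sum_(i < n) (encoder_entropy i.+1 - encoder_entropy i))).
  apply: ler_sum => i _.
  have auxiliary_future : function_of (auxiliary i) (future i.+1).
    move=> w w' [eT /rv_seqP eZ /rv_restrictP eX]; apply: auxiliary_congr => // j _.
    exact: eZ.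
  apply: (cond_info_le_entropy_drop P_ge0 (X_future_given_auxiliary i)) => w w'.
  - move=> e; congr (_, _); first exact: auxiliary_future.
    by case: e => _ /rv_seqP eZ _; apply: eZ.
  - move=> e; apply: VTU; congr (_, _); first exact: (congr1 fst e).
    exact: (auxiliary_future _ _ (congr1 snd e)).
  - case=> eT eZ /rv_restrictP eX; congr (_, (_, _, _)) => //; first exact: eX.
    by apply/rv_restrictP => j ij; apply: eX; apply: ltnW.
rewrite -(big_mkord xpredT (fun k => encoder_entropy k.+1 - encoder_entropy k)).
rewrite telescope_sumr// -[M in leRHS]card_ord.
apply: le_trans (entropy_le_ln_card P_pmf encoder_message).
have := cond_entropy_ge0 P_ge0 encoder_message (future 0).
have := cond_entropy_le P_pmf encoder_message (future n).
by rewrite /encoder_entropy; lra.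
Qed.

Variables (Xh : finType) (d : X -> Xh -> R).
Variable g : 'I_M -> 'I_M1 -> {ffun 'I_n -> Z} -> {ffun 'I_n -> Xh}.

Lemma code_distortion_coords : code_distortion pZY W d f1 f g =
  n%:R^-1 * \sum_i expect P (fun w => d (coordX i w)
    (g (encoder_message w) (helper_message w) (rv_seq letterZ w) i)).
Proof.
have law_letters : law (source pZY W) [% letterX, letterY, letterZ] =1 source pZY W.
  by move=> [[x y] z]; rewrite /law (big_pred1 (x, y, z)).
rewrite (code_distortionE d f1 f g law_letters) -expect_sum -expectZ.
apply: eq_bigr => w _; congr (_ * (_ * _)).
by apply: eq_bigr => i _; rewrite ffunE.
Qed.

Lemma code_within_budget : (0 < n)%N ->
  exists (U : finType) (q : Y -> U -> R) (r : X * U -> {ffun Z -> Xh} -> R),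
  within_budget pZY W d (budget pZY W (code_distortion pZY W d f1 f g)
    (n%:R^-1 * ln M%:R) (n%:R^-1 * ln M1%:R)) q r.
Proof.
move=> n_gt0; have n0 : 0 < n%:R :> R by rewrite ltr0n.
have [V /all_and2[VTU le_V]] := choice (fun i => exists_strategy i d g).
have letter i := within_budget_of_cond_indep d P_pmf (law_coord i)
  (XZ_auxiliary_given_Y i) (YZ_strategy_given_X_auxiliary (VTU i)).
have I_gt0 : (0 < #|'I_n|)%N by rewrite card_ord.
have average := within_budget_average pZY_pmf W_channel I_gt0 letter.
eexists _, _, _; apply: within_budgetW average => k.
rewrite card_ord /budget; case: k => -[|[|[|//]]] lt_k;
  under eq_bigr => i _ do rewrite (tnth_nth 0) /=; rewrite (tnth_nth 0) /=.
- rewrite sumrB sumr_const card_ord -[equivocation _ _ *+ n]mulr_natl mulrBr.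
  rewrite mulKf ?gt_eqF//.
  by rewrite lerD2r ler_pM2l ?invr_gt0// helper_rate.
- by rewrite ler_pM2l ?invr_gt0// encoder_rate.
- by rewrite code_distortion_coords ler_pM2l ?invr_gt0// ler_sum.
Qed.

End Code.

Section Necessity.
Variables (R : realType) (X Y Z Xh : finType).
Variables (pZY : Z * Y -> R) (W : Z -> X -> R) (d : X -> Xh -> R).
Hypotheses (pZY_pmf : is_pmf pZY) (W_channel : is_channel W).

Lemma ln_le_powR (n M : nat) (a : R) : (0 < n)%N -> (0 < M)%N ->
  M%:R <= powR 2 (n%:R * a) -> n%:R^-1 * ln M%:R <= a * ln 2.
Proof.
move=> n_gt0 M_gt0 le_M; rewrite mulrC ler_pdivrMr ?ltr0n//.
have : ln M%:R <= ln (powR 2 (n%:R * a)) by rewrite ler_ln// posrE ?powR_gt0// ltr0n.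
by rewrite ln_powR => /le_trans; apply; lra.
Qed.

Lemma op_region_sl_region D Rt R1 :
  op_region pZY W d D Rt R1 -> sl_region pZY W d D Rt R1.
Proof.
move=> op; have ln2 : 0 < ln 2 :> R by rewrite ln_gt0// ltr1n.
have [z0 y0] := pmf_inhabited pZY_pmf; have x0 := pmf_inhabited (W_channel z0).
suff [q [r within]] : exists (q : Y -> 'I_#|{: Y + 'I_3}| -> R) r, within_budget pZY W d
    (budget pZY W D (Rt * ln 2) (R1 * ln 2)) q r.
  exact: (within_budget_sl_region pZY_pmf W_channel within).
apply: within_budget_closed => // e e0.
have [|Rt' [R1' [ach [near_Rt near_R1]]]] := op (e / ln 2); first exact: divr_gt0.
have [N code] := ach e e0.
have [M1 [M [le_M1 [le_M [f1 [f [g le_D]]]]]]] := code N.+1 (leqnSn N).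
have M1_gt0 : (0 < M1)%N := leq_ltn_trans (leq0n _) (ltn_ord (f1 [ffun=> y0])).
have M_gt0 : (0 < M)%N.
  exact: leq_ltn_trans (leq0n _) (ltn_ord (f [ffun=> x0] (f1 [ffun=> y0]))).
have [U [q [r within]]] := code_within_budget pZY_pmf W_channel f1 f d g (ltn0Sn N).
have u0 := pmf_inhabited ((let: And3 q_channel _ _ := within in q_channel) y0).
apply: (within_budget_card pZY_pmf W_channel u0).
apply: within_budgetW within => k; rewrite /budget.
have rate_e a a' : `|a - a'| < e / ln 2 -> a' * ln 2 <= a * ln 2 + e.
  move=> near_a; have : a' - a < e / ln 2.
    by apply: le_lt_trans near_a; rewrite distrC ler_norm.
  by rewrite ltr_pdivlMr//; lra.
case: k => -[|[|[|//]]] lt_k; rewrite !(tnth_nth 0) //=.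
- rewrite addrAC lerD2r; apply: le_trans (rate_e _ _ near_R1).
  exact: ln_le_powR.
- by apply: le_trans (rate_e _ _ near_Rt); apply: ln_le_powR.
Qed.

End Necessity.

Theorem theorem3 (R : realType) (X Y Z Xh : finType)
  (pZY : Z * Y -> R) (W : Z -> X -> R) (d : X -> Xh -> R)
  (HpZY : is_pmf pZY) (HW : is_channel W) (Hd : forall x xh, 0 <= d x xh)
  (D : R) :
  forall Rt R1 : R,
    op_region pZY W d D Rt R1 <-> sl_region pZY W d D Rt R1.
Proof.
move=> Rt R1; split; first exact: op_region_sl_region.
exact: sl_region_op_region.
Qed.
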